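(* Let $\diamondsuit\in\mathcal{F}$. If a sequence of subspaces $(H_m)_{m\in\mathbb{N}}$ of $\mathbb{R}^n$ is shape-stable for $\diamondsuit$ in $\mathcal{K}^n$ with rotations $(\mathbb{A}_m)$, then $(H_m)$ is shape-stable in $\mathcal{K}^n$ with the same rotations $(\mathbb{A}_m)$ for every symmetrization $\spadesuit\in\mathcal{F}$. In particular, a sequence of subspaces $(H_m)$ is shape-stable in $\mathcal{K}^n$ for $\diamondsuit\in\mathcal{F}$ if and only if the same property holds for fiber symmetrization, and if and only if it holds for Minkowski symmetrization. If the $H_m$ are hyperplanes, the same conclusion holds for Steiner symmetrization.
   Context: $\mathcal{K}^n$ is the family of nonempty compact convex subsets of $\mathbb{R}^n$, equipped with the Hausdorff distance; convergence of sets is in this distance. ''Subspace'' means linear subspace of dimension $i$ with $1\le i\le n-1$; a hyperplane is a subspace of dimension $n-1$. The dimensions of the subspaces in a sequence may vary. For a subspace $H$, $H^\perp$ is its orthogonal complement, $P_{H^\perp}$ is orthogonal projection onto $H^\perp$, and $R_H(x)=x-2P_{H^\perp}x$ is the reflection with respect to $H$. $A+B=\{a+b: a\in A,\ b\in B\}$ is the Minkowski sum. Rotations are linear rotations of $\mathbb{R}^n$ about the origin. An $H$-symmetrization on $\mathcal{K}^n$ is a map $\diamondsuit_H:\mathcal{K}^n\to\{K\in\mathcal{K}^n: R_HK=K\}$. A symmetrization $\diamondsuit$ on $\mathcal{K}^n$ assigns to every subspace $H$ an $H$-symmetrization $\diamondsuit_H$. $\mathcal{F}$ is the family of all symmetrizations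 $\diamondsuit$ on $\mathcal{K}^n$ such that for every subspace $H$: (monotonicity) $K\subseteq L$ implies $\diamondsuit_HK\subseteq\diamondsuit_HL$ for all $K,L\in\mathcal{K}^n$; ($H^\perp$-translation invariance for $H$-symmetric sets) if $K\in\mathcal{K}^n$ and $R_HK=K$, then $\diamondsuit_H(K+x)=K$ for every $x\in H^\perp$; (invariance for $H$-symmetric sets) if $K\in\mathcal{K}^n$ and $R_HK=K$, then $\diamondsuit_HK=K$. A sequence of subspaces $(H_m)$ is shape-stable in $\mathcal{K}^n$ for $\diamondsuit$ with rotations $(\mathbb{A}_m)$ if $(\mathbb{A}_m)$ is a sequence of rotations such that for every $k\in\mathbb{N}$ and every $K\in\mathcal{K}^n$ the sequence $\mathbb{A}_m\diamondsuit_{H_m}\cdots\diamondsuit_{H_k}K$, $m\ge k$, converges; here $(\mathbb{A}_m)$ is independent of $K$ and $k$. It is shape-stable for $\diamondsuit$ if such a sequence of rotations exists. Minkowski symmetrization: $M_HK=\frac{K+R_HK}{2}$. Fiber symmetrization: $F_HK=\bigcup_{x\in H}\frac{1}{2}\big[(K\cap(H^\perp+x))+R_H(K\cap(H^\perp+x))\big]$, with empty sections contributing the empty set. Steiner symmetrization with respect to a hyperplane $H$: $S_HK$ is the union over $x\in H$ with $K\cap(H^\perp+x)\neq\emptyset$ of the closed segment (or point) in $H^\perp+x$ centered at $x$ having the same length as $K\cap(H^\perp+x)$. *)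

(* Defs.v *)
From HB Require Import structures.
From mathcomp Require Import all_boot all_order all_algebra.
From mathcomp Require Import all_classical all_reals all_analysis.
Import Order.TTheory GRing.Theory Num.Theory.
Import numFieldNormedType.Exports.
Set Implicit Arguments.
Unset Strict Implicit.
Unset Printing Implicit Defensive.
Local Open Scope classical_set_scope.
Local Open Scope ring_scope.

Section Euclidean.
Context (R : realType) (n : nat).
Implicit Types (u v x : 'rV[R]_n) (H : {vspace 'rV[R]_n}) (K L : set 'rV[R]_n).

Definition dot u v : R := (u *m v^T) 0 0.

Lemma dotC u v : dot u v = dot v u.
Proof. by rewrite /dot -[u *m v^T]trmxK trmx_mul trmxK mxE. Qed.

Lemma dot_is_linearl v : GRing.linear_for *%R (dot^~ v).
Proof. by move=> a u w; rewrite /dot mulmxDl -scalemxAl !mxE. Qed.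

Lemma dot_is_bilinear : bilinear_for *%R (idfun \; *%R) dot.
Proof.
split=> [|u a v w]; first exact: dot_is_linearl.
by rewrite dotC dot_is_linearl !(dotC _ u).
Qed.

HB.instance Definition _ :=
  bilinear_isBilinear.Build R _ _ _
    (GRing.Scale.Law.clone _ _ ( *%R ) _)
    (GRing.Scale.Law.clone _ _ (idfun \; *%R ) _)
    dot dot_is_bilinear.

Lemma dot_is_hermitian u v : dot u v = (-1) ^+ false * idfun (dot v u).
Proof. by rewrite expr0 mul1r dotC. Qed.

HB.instance Definition _ :=
  @isHermitianSesquilinear.Build R _ false idfun dot dot_is_hermitian.

Lemma dot_gt0 u : u != 0 -> 0 < dot u u.
Proof.
move=> u0; have dE : dot u u = \sum_j u 0 j ^+ 2.
  by rewrite /dot mxE; apply: eq_bigr => j _; rewrite mxE expr2.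
rewrite dE lt_neqAle sumr_ge0 ?andbT; last by move=> j _; exact: sqr_ge0.
apply: contra_neq u0 => /esym s0; apply/rowP => j; rewrite mxE.
apply/eqP; rewrite -sqrf_eq0; apply/eqP.
by apply: (psumr_eq0P _ s0) => // i _; exact: sqr_ge0.
Qed.

HB.instance Definition _ := isDotProduct.Build R _ dot dot_gt0.

(* The norm `|x| of the library on 'rV[R]_n is the sup norm, whence this
   definition; both induce the same topology. *)
Definition enorm x : R := Num.sqrt (dot x x).

Definition orthoc H : {vspace 'rV[R]_n} := orthov dot H.

(* [daddv_pi U V] is the projection onto [U] along [V]. *)
Definition proj_orthoc H x : 'rV[R]_n := daddv_pi (orthoc H) H x.

Definition reflection H x : 'rV[R]_n := x - 2 *: proj_orthoc H x.

Definition proper_subspace H : Prop := (1 <= \dim H <= n.-1)%N.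

Definition hyperplane H : Prop := proper_subspace H /\ \dim H = n.-1.

Definition rotation (A : 'M[R]_n) : Prop := A *m A^T = 1%:M /\ \det A = 1.

(* Vectors are rows, so a matrix acts on the right. *)
Definition rotate (A : 'M[R]_n) K : set 'rV[R]_n := [set x *m A | x in K].

Definition translate x K : set 'rV[R]_n := [set y + x | y in K].

Definition msum K L : set 'rV[R]_n := [set x + y | x in K & y in L].

Definition half_set K : set 'rV[R]_n := [set 2^-1 *: x | x in K].

Definition convex_body K : Prop :=
  [/\ K !=set0, compact K & convex_set (K : set (convex_lmodType 'rV[R]_n))].

Definition parallel_body K (e : R) : set 'rV[R]_n :=
  msum K [set x | enorm x <= e].

Definition hausdorff_dist K L : R :=
  inf [set e : R |
    [/\ 0 <= e, K `<=` parallel_body L e & L `<=` parallel_body K e]].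

Definition hausdorff_cvg (K_ : nat -> set 'rV[R]_n) : Prop :=
  exists2 L, convex_body L & hausdorff_dist (K_ m) L @[m --> \oo] --> (0 : R).

End Euclidean.

Section Symmetrizations.
Context (R : realType) (n : nat).
Implicit Types (x : 'rV[R]_n) (H : {vspace 'rV[R]_n}) (K L : set 'rV[R]_n).

(* Families of maps on all sets; every condition below only involves their
   values on convex bodies and at subspaces of dimension 1, ..., n - 1. *)
Definition set_operation := {vspace 'rV[R]_n} -> set 'rV[R]_n -> set 'rV[R]_n.

Implicit Types S : set_operation.

Definition refl_symmetric H K : Prop := reflection H @` K = K.

Definition symmetrization S : Prop :=
  forall H, proper_subspace H -> forall K, convex_body K ->
    convex_body (S H K) /\ refl_symmetric H (S H K).

Definition monotone_symm S : Prop :=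
  forall H, proper_subspace H -> forall K L, convex_body K -> convex_body L ->
    K `<=` L -> S H K `<=` S H L.

Definition translation_invariant_symm S : Prop :=
  forall H, proper_subspace H -> forall K, convex_body K -> refl_symmetric H K ->
    forall x, x \in orthoc H -> S H (translate x K) = K.

Definition invariant_symm S : Prop :=
  forall H, proper_subspace H -> forall K, convex_body K -> refl_symmetric H K ->
    S H K = K.

Definition familyF S : Prop :=
  [/\ symmetrization S, monotone_symm S, translation_invariant_symm S &
      invariant_symm S].

(* S_(H_m) ( ... (S_(H_k) K)), for k <= m *)
Definition successive S (H_ : nat -> {vspace 'rV[R]_n}) (k m : nat) K :=
  foldl (fun L i => S (H_ i) L) K (index_iota k m.+1).

Definition shape_stable_with S (H_ : nat -> {vspace 'rV[R]_n})
    (A_ : nat -> 'M[R]_n) : Prop :=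
  (forall m, rotation (A_ m)) /\
  (forall k K, convex_body K ->
    hausdorff_cvg (fun m => rotate (A_ m) (successive S H_ k m K))).

Definition shape_stable S (H_ : nat -> {vspace 'rV[R]_n}) : Prop :=
  exists A_, shape_stable_with S H_ A_.

Definition minkowski_symm : set_operation :=
  fun H K => half_set (msum K (reflection H @` K)).

Definition fiber_section H x K : set 'rV[R]_n :=
  K `&` translate x [set y | y \in orthoc H].

Definition fiber_symm : set_operation :=
  fun H K => \bigcup_(x in [set x | x \in H])
    half_set (msum (fiber_section H x K) (reflection H @` fiber_section H x K)).

(* When K is a compact segment (or a point), its diameter is its length. *)
Definition segment_length K : R := sup [set enorm (x - y) | x in K & y in K].

Definition steiner_symm : set_operation :=
  fun H K =>
    \bigcup_(x in [set x | x \in H /\ fiber_section H x K !=set0])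
      [set y | y - x \in orthoc H /\
               enorm (y - x) <= segment_length (fiber_section H x K) / 2].

End Symmetrizations.

(* Main.v *)
Require Import Defs.
From HB Require Import structures.
From mathcomp Require Import all_boot all_order all_algebra.
From mathcomp Require Import all_classical all_reals all_analysis.
From mathcomp Require Import ring lra zify.
From mathcomp Require mxtens.
Import Order.TTheory GRing.Theory Num.Theory.
Import numFieldNormedType.Exports.
(* [msum] must denote the Minkowski sum, not the sum of measures. *)
Import Defs.
Set Implicit Arguments.
Unset Strict Implicit.
Unset Printing Implicit Defensive.
Local Open Scope classical_set_scope.
Local Open Scope ring_scope.

(** Write [h_K] for the support function of a body [K], [M_H] and [F_H] for
    Minkowski and fiber symmetrization. Every [S] of the family satisfies
    [F_H K `<=` S H K `<=` M_H K] ([fiber_sub_familyF], [familyF_sub_minkowski]), and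
    both bounds belong to the family; on bodies and for hyperplanes, Steiner and fiber
    symmetrization agree ([steiner_fiber]). So it is enough to show that stability
    passes from any [S] to [M], and from [M] to any [T], with the same rotations.
    By [hausdorff_cvgP], convergence means that the support functions are uniformly
    Cauchy on the unit sphere.

    From [M] to [T] ([minkowski_stable_familyF]). Let [K_m] be the [T]-process and
    [Y_(j,m)] the Minkowski process started at [K_j], so that [K_m `<=` Y_(j,m)] and
    [Y_(j,m)] decreases in [j]. By stability of [M], each [Y_(j,m)], rotated, converges
    as [m] grows; the limits decrease in [j], hence at finitely many directions they
    differ little for large [j]. A gap between [K_m] and [Y_(j,m)] in one direction
    would survive in the limit: for a suitable finite net of directions, the sum of the
    gaps over every rotated copy of the net is bounded below
    ([net_gap_lower_bound]), and Minkowski symmetrization, which averages over rotated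
    copies, preserves this bound ([net_gap_minkowski]). So [K_m] follows [Y_(j,m)].

    From [S] to [M] ([familyF_stable_minkowski]). The point is that, for a large
    radius [r], the [S]-process started at [K + r B], with [B] the unit ball, stays
    uniformly close to the Minkowski process ([process_large_ball]). The upper bound
    is the inclusion in [M_H]. For the lower bound, [h_K] is approximated on the
    sphere by a function [p] from a finite-dimensional space of smooth functions on
    which reflections act by isometries ([feature_limit_supp]); Minkowski
    symmetrization replaces [p] by its even part under the reflection. By duality,
    the support function of [F_H X] at [x] is the infimum over [w] in [H] of the mean
    of the values of [h_X] at [x + w] and at the reflection of [x - w]
    ([supp_fiber_ge]). If [h_X] is at least [r + p] on the sphere, the strict
    convexity of [r] times the norm penalises [w] quadratically, whereas [w] gains
    only through the odd part of [p], to first order. So one step loses at most a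
    constant times [||odd part|| ^+ 2 / r] ([fiber_step]). By orthogonality,
    [||odd part|| ^+ 2] is the decrease of [||p|| ^+ 2]: the losses telescope, and
    their sum is small for large [r], however many steps are made. *)
(** * The Euclidean inner product on row vectors *)

Section InnerProduct.
Context (R : realType) (n : nat).
Implicit Types (u v w x y z : 'rV[R]_n) (a b : R).

Lemma dotE u v : dot u v = \sum_j u 0 j * v 0 j.
Proof. by rewrite /dot mxE; apply: eq_bigr => j _; rewrite mxE. Qed.

Lemma dotDl u v w : dot (u + v) w = dot u w + dot v w.
Proof. by rewrite /dot mulmxDl mxE. Qed.
Lemma dotDr u v w : dot w (u + v) = dot w u + dot w v.
Proof. by rewrite dotC dotDl !(dotC w). Qed.
Lemma dotZl a u v : dot (a *: u) v = a * dot u v.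
Proof. by rewrite /dot -scalemxAl mxE. Qed.
Lemma dotZr a u v : dot u (a *: v) = a * dot u v.
Proof. by rewrite dotC dotZl dotC. Qed.
Lemma dotNl u v : dot (- u) v = - dot u v.
Proof. by rewrite -scaleN1r dotZl mulN1r. Qed.
Lemma dotNr u v : dot u (- v) = - dot u v.
Proof. by rewrite dotC dotNl dotC. Qed.
Lemma dot0l u : dot 0 u = 0.
Proof. by rewrite /dot mul0mx mxE. Qed.
Lemma dot0r u : dot u 0 = 0.
Proof. by rewrite dotC dot0l. Qed.
Lemma dotBl u v w : dot (u - v) w = dot u w - dot v w.
Proof. by rewrite dotDl dotNl. Qed.
Lemma dotBr u v w : dot w (u - v) = dot w u - dot w v.
Proof. by rewrite dotDr dotNr. Qed.
Definition dot_lin := (dotDl, dotDr, dotNl, dotNr, dotZl, dotZr, dot0l, dot0r).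

Lemma dot_ge0 u : 0 <= dot u u.
Proof. by have [->|/dot_gt0/ltW//] := eqVneq u 0; rewrite dot0l. Qed.

Lemma dot_eq0 u : dot u u = 0 -> u = 0.
Proof.
by move=> du; apply: contraTeq isT => /dot_gt0; rewrite du ltxx.
Qed.

Lemma enorm_ge0 u : 0 <= enorm u. Proof. exact: sqrtr_ge0. Qed.
Lemma enorm_sqr u : enorm u ^+ 2 = dot u u.
Proof. by rewrite sqr_sqrtr ?dot_ge0. Qed.
Lemma enorm0 : enorm (0 : 'rV[R]_n) = 0.
Proof. by rewrite /enorm dot0l sqrtr0. Qed.
Lemma enorm_eq0 u : enorm u = 0 -> u = 0.
Proof. by move=> u0; apply: dot_eq0; rewrite -enorm_sqr u0 expr0n. Qed.
Lemma enorm_gt0 u : u != 0 -> 0 < enorm u.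
Proof. by move=> u0; rewrite sqrtr_gt0 dot_gt0. Qed.

Lemma enormZ a u : enorm (a *: u) = `|a| * enorm u.
Proof.
rewrite /enorm dotZl dotZr mulrA -expr2 sqrtrM ?sqr_ge0 //.
by rewrite sqrtr_sqr.
Qed.
Lemma enormN u : enorm (- u) = enorm u.
Proof. by rewrite /enorm dotNl dotNr opprK. Qed.
Lemma enormB u v : enorm (u - v) = enorm (v - u).
Proof. by rewrite -enormN opprB. Qed.

(** The square of [enorm v *: u - enorm u *: v] is nonnegative. *)
Lemma cauchy_schwarz u v : dot u v <= enorm u * enorm v.
Proof.
have [->|u0] := eqVneq u 0; first by rewrite dot0l enorm0 mul0r.
have [->|v0] := eqVneq v 0; first by rewrite dot0r enorm0 mulr0.
have nu := enorm_gt0 u0; have nv := enorm_gt0 v0.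
have := dot_ge0 (enorm v *: u - enorm u *: v).
rewrite !dot_lin -!enorm_sqr (dotC v u).
set a := enorm u; set b := enorm v; set c := dot u v => h.
have : 0 <= 2 * (a * b) * (a * b - c) by nra.
by rewrite pmulr_rge0 ?subr_ge0 // !mulr_gt0.
Qed.

Lemma cauchy_schwarz_abs u v : `|dot u v| <= enorm u * enorm v.
Proof.
rewrite ler_norml cauchy_schwarz andbT lerNl -dotNl -(enormN u).
exact: cauchy_schwarz.
Qed.

Lemma enormD u v : enorm (u + v) <= enorm u + enorm v.
Proof.
rewrite -(ler_pXn2r (n:=2)) ?nnegrE ?addr_ge0 ?enorm_ge0 //.
rewrite enorm_sqr !dot_lin -!enorm_sqr (dotC v u).
by have := cauchy_schwarz u v; nra.
Qed.

Lemma enorm_triangle u v w : enorm (u - w) <= enorm (u - v) + enorm (v - w).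
Proof. by rewrite (le_trans _ (enormD _ _)) // addrA subrK. Qed.

Lemma coord_le_enorm u j : `|u 0 j| <= enorm u.
Proof.
rewrite -sqrtr_sqr ler_sqrt ?dot_ge0 // dotE (bigD1 j) //= -expr2 lerDl.
by apply: sumr_ge0 => i _; rewrite -expr2 sqr_ge0.
Qed.

Lemma norm_le_enorm u : `|u| <= enorm u.
Proof.
rewrite [leLHS]/Num.norm /= mx_normrE; apply/bigmax_leP; split; first exact: enorm_ge0.
by move=> [i j] _ /=; rewrite (ord1 i) coord_le_enorm.
Qed.

Lemma coord_le_norm u j : `|u 0 j| <= `|u|.
Proof.
by rewrite [leRHS]/Num.norm /= mx_normrE; apply/bigmax_geP; right; exists (0, j).
Qed.

Lemma enorm_le_norm u : enorm u <= n%:R * `|u|.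
Proof.
have dn : dot u u <= n%:R * `|u| ^+ 2.
  rewrite dotE; apply: (le_trans (y := \sum_(j < n) `|u| ^+ 2)).
    apply: ler_sum => j _; rewrite -expr2 -(real_normK (num_real _)).
    by rewrite ler_pXn2r ?nnegrE ?normr_ge0 ?coord_le_norm.
  by rewrite sumr_const card_ord -[leLHS]mulr_natl.
rewrite -(ler_pXn2r (n:=2)) ?nnegrE ?mulr_ge0 ?enorm_ge0 ?ler0n ?normr_ge0 //.
rewrite enorm_sqr (le_trans dn) // exprMn ler_wpM2r ?sqr_ge0 //.
by rewrite -natrX ler_nat; case: (n) => // k; rewrite leq_pmulr.
Qed.

Lemma polar_decomposition x v : enorm x = 1 ->
  exists2 t : 'rV[R]_n, enorm t = 1 & v = enorm v *: t.
Proof.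
move=> x1; have [->|v0] := eqVneq v 0.
  by exists x => //; rewrite enorm0 scale0r.
have nv := enorm_gt0 v0.
exists ((enorm v)^-1 *: v).
  by rewrite enormZ ger0_norm ?invr_ge0 ?enorm_ge0 // mulVf ?gt_eqF.
by rewrite scalerA divff ?scale1r // gt_eqF.
Qed.

Lemma exists_unit : (0 < n)%N -> exists u : 'rV[R]_n, enorm u = 1.
Proof.
move=> n0; exists (delta_mx 0 (Ordinal n0)).
rewrite /enorm dotE (bigD1 (Ordinal n0)) //= big1 ?addr0 => [|j jn].
  by rewrite mxE !eqxx mulr1 sqrtr1.
by rewrite !mxE (negbTE jn) andbF mul0r.
Qed.

Lemma enorm_le_of_dot c u : (0 < n)%N -> (forall v, enorm v = 1 -> dot v u <= c) ->
  enorm u <= c.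
Proof.
move=> /exists_unit[v v1] h; have [u0|u0] := eqVneq u 0.
  by have := h _ v1; rewrite u0 dot0r enorm0.
have nu := enorm_gt0 u0.
have := h ((enorm u)^-1 *: u).
rewrite enormZ ger0_norm ?invr_ge0 ?enorm_ge0 // mulVf ?gt_eqF // => /(_ erefl).
by rewrite dotZl -enorm_sqr expr2 mulrA mulVf ?mul1r ?gt_eqF.
Qed.

Lemma lipschitz_continuous (V : normedModType R) (f : 'rV[R]_n -> V) c :
  (forall x y, `|f x - f y| <= c * enorm (x - y)) -> continuous f.
Proof.
move=> fc x; apply/(@cvgrPdist_lt _ _ _ (nbhs x) (nbhs_filter x)) => e e0.
(* The neighbourhoods are those of the sup norm; [n%:R] compares it with [enorm]. *)
pose d := e / ((`|c| + 1) * (n%:R + 1)).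
have p1 : 0 < (`|c| + 1) * (n%:R + 1) :> R.
  by rewrite mulr_gt0 // ltr_wpDl.
have d0 : 0 < d by rewrite divr_gt0.
have : nbhs x (ball x d) by exact: nbhsx_ballx.
apply: (@filterS _ (nbhs x) (nbhs_filter x)) => y; rewrite -ball_normE /= ltr_pdivlMr // => h.
apply: le_lt_trans (fc _ _) _; apply: le_lt_trans h.
have h1 := enorm_le_norm (x - y); have h2 := normr_ge0 (x - y).
have h3 := enorm_ge0 (x - y); have h4 := ler_norm c; have h5 := normr_ge0 c.
have N0 : 0 <= n%:R :> R by [].
apply: (le_trans (y := `|c| * enorm (x - y))); first by rewrite ler_wpM2r.
apply: (le_trans (y := (`|c| + 1) * enorm (x - y))); first by rewrite ler_wpM2r // lerDl.
rewrite mulrCA ler_wpM2l ?addr_ge0 //.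
by rewrite (le_trans h1) // mulrC ler_wpM2l // lerDl.
Qed.

Lemma dot_continuous u : continuous (dot u : 'rV[R]_n -> R^o).
Proof.
by apply: (@lipschitz_continuous _ _ (enorm u)) => x y; rewrite -dotBr cauchy_schwarz_abs.
Qed.

Lemma enorm_lip u v : `|enorm u - enorm v| <= enorm (u - v).
Proof.
have h1 := enormD (u - v) v; have h2 := enormD (v - u) u.
move: h1 h2; rewrite !subrK (enormB v u) ler_norml => h1 h2.
by apply/andP; split; lra.
Qed.

Lemma enorm_continuous : continuous (@enorm R n : 'rV[R]_n -> R^o).
Proof.
by apply: (@lipschitz_continuous _ _ 1) => x y; rewrite mul1r enorm_lip.
Qed.

End InnerProduct.

(** * Orthogonal complements and reflections *)

Section Reflections.
Context (R : realType) (n : nat).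
Implicit Types (u v w x y z : 'rV[R]_n) (H : {vspace 'rV[R]_n}).

Lemma mem_orthocP H u : reflect (forall h, h \in H -> dot u h = 0) (u \in orthoc H).
Proof. by apply: (iffP mem_orthovP). Qed.

(** Each linear form lowers the dimension by at most one; hence the orthogonal
    complement of [H] is large enough for the two to span the whole space. *)
Lemma dim_bigcap_lker (f : nat -> 'Hom('rV[R]_n, R^o)) k :
  (n <= \dim (\bigcap_(i < k) lker (f i))%VS + k)%N.
Proof.
elim: k => [|k IH]; first by rewrite big_ord0 dimvf /dim /= mul1n addn0.
rewrite big_ord_recr /=; set W := (\bigcap_(i < k) _)%VS in IH *.
have := limg_ker_dim (f k) W.
have : (\dim (f k @: W) <= 1)%N.
  by rewrite (leq_trans (dimvS (subvf _))) // dimvf.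
by lia.
Qed.

Lemma capv_orthoc H : (orthoc H :&: H)%VS = 0%VS.
Proof.
apply/eqP; rewrite -subv0; apply/subvP => v; rewrite memv_cap memv0.
by case/andP=> /mem_orthocP hv /hv /dot_eq0 ->.
Qed.

(** This makes [proj_orthoc H] a genuine orthogonal projection: [daddv_pi] has no
    meaning outside of the sum of the two subspaces. *)
Lemma addv_orthoc H : (orthoc H + H)%VS = fullv.
Proof.
apply/eqP; rewrite eqEdim subvf /= dimvf /dim /= mul1n.
rewrite dimv_disjoint_sum ?capv_orthoc //.
exact: (dim_bigcap_lker (fun i => linfun (applyr (@dot R n) (vbasis H)`_i : 'rV[R]_n -> R^o))).
Qed.

Lemma proj_orthoc_mem H x : proj_orthoc H x \in orthoc H.
Proof. exact: memv_pi. Qed.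

Lemma sub_proj_orthoc_mem H x : x - proj_orthoc H x \in H.
Proof.
have := @daddv_pi_add _ _ (orthoc H) H x (capv_orthoc H).
rewrite addv_orthoc => /(_ (memvf _)) h.
by rewrite -{1}h /proj_orthoc addrC addKr memv_pi.
Qed.

Lemma proj_orthocD H x y : proj_orthoc H (x + y) = proj_orthoc H x + proj_orthoc H y.
Proof. exact: linearD. Qed.
Lemma proj_orthocZ H a x : proj_orthoc H (a *: x) = a *: proj_orthoc H x.
Proof. exact: linearZ. Qed.
Lemma proj_orthocB H x y : proj_orthoc H (x - y) = proj_orthoc H x - proj_orthoc H y.
Proof. exact: linearB. Qed.

Lemma proj_orthoc_id H x : x \in orthoc H -> proj_orthoc H x = x.
Proof. by move=> xH; rewrite /proj_orthoc daddv_pi_id // capv_orthoc. Qed.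

Lemma dot_orthoc H h u : h \in H -> u \in orthoc H -> dot h u = 0.
Proof. by move=> hH /mem_orthocP /(_ _ hH); rewrite dotC. Qed.

Lemma proj_orthoc_sub H x : x \in H -> proj_orthoc H x = 0.
Proof.
move=> xH; have pH : proj_orthoc H x \in H.
  by rewrite -[proj_orthoc H x](subKr x) rpredB ?sub_proj_orthoc_mem.
by apply: dot_eq0; apply: dot_orthoc pH (proj_orthoc_mem _ _).
Qed.

Lemma dot_proj_orthoc H x y : dot (proj_orthoc H x) y = dot x (proj_orthoc H y).
Proof.
rewrite -{1}(subrK (proj_orthoc H y) y) -{2}(subrK (proj_orthoc H x) x).
rewrite dotDr dotDl (dot_orthoc (sub_proj_orthoc_mem H x)) ?proj_orthoc_mem //.
by rewrite dotC (dot_orthoc (sub_proj_orthoc_mem H y)) ?proj_orthoc_mem.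
Qed.

Lemma reflectionD H x y : reflection H (x + y) = reflection H x + reflection H y.
Proof. by rewrite /reflection proj_orthocD scalerDr opprD addrACA. Qed.
Lemma reflectionZ H a x : reflection H (a *: x) = a *: reflection H x.
Proof. by rewrite /reflection proj_orthocZ scalerBr !scalerA mulrC. Qed.
Lemma reflectionN H x : reflection H (- x) = - reflection H x.
Proof. by rewrite -[- x]scaleN1r reflectionZ scaleN1r. Qed.
Lemma reflectionB H x y : reflection H (x - y) = reflection H x - reflection H y.
Proof. by rewrite reflectionD reflectionN. Qed.

Lemma reflection_sub H x : x \in H -> reflection H x = x.
Proof. by move=> xH; rewrite /reflection proj_orthoc_sub // scaler0 subr0. Qed.
Lemma reflection_orthoc H x : x \in orthoc H -> reflection H x = - x.
Proof.
by move=> xH; rewrite /reflection proj_orthoc_id // scaler_nat mulr2n opprD addNKr.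
Qed.

Lemma reflectionK H x : reflection H (reflection H x) = x.
Proof.
rewrite {2}/reflection reflectionB reflectionZ.
rewrite (reflection_orthoc (proj_orthoc_mem _ _)) /reflection scalerN opprK.
by rewrite subrK.
Qed.

Lemma dot_reflection H x y : dot (reflection H x) y = dot x (reflection H y).
Proof. by rewrite /reflection !dot_lin dot_proj_orthoc. Qed.

Lemma enorm_reflection H x : enorm (reflection H x) = enorm x.
Proof. by rewrite /enorm dot_reflection reflectionK. Qed.

Lemma sub_reflection H x : x - reflection H x = 2 *: proj_orthoc H x.
Proof. by rewrite /reflection opprB addrC subrK. Qed.

Lemma dot_orthoc_decomposition H x :
  dot x x = dot (x - proj_orthoc H x) (x - proj_orthoc H x)
            + dot (proj_orthoc H x) (proj_orthoc H x).
Proof.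
set p := proj_orthoc H x; set q := x - p.
have -> : dot x x = dot (q + p) (q + p) by rewrite subrK.
have qp : dot q p = 0 by rewrite (dot_orthoc (sub_proj_orthoc_mem H x)) ?proj_orthoc_mem.
by clearbody q; rewrite !dot_lin (dotC p) qp addr0 add0r.
Qed.

Definition reflection_mx H : 'M[R]_n := lin1_mx (reflection H).

Lemma mul_reflection_mx H x : x *m reflection_mx H = reflection H x.
Proof.
rewrite [x in RHS]row_sum_delta /reflection_mx.
apply/rowP => j; rewrite mxE.
have -> : reflection H (\sum_i x 0 i *: delta_mx 0 i) =
   \sum_i x 0 i *: reflection H (delta_mx 0 i).
  elim/big_rec2: _ => [|i y1 y2 _ <-]; last by rewrite reflectionD reflectionZ.
  by rewrite reflection_sub ?mem0v.
by rewrite summxE; apply: eq_bigr => i _; rewrite !mxE.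
Qed.

Lemma dot_mulmx (A : 'M[R]_n) x y : dot (x *m A) y = dot x (y *m A^T).
Proof. by rewrite /dot trmx_mul trmxK mulmxA. Qed.

Lemma reflection_mx_orthogonal H : reflection_mx H *m (reflection_mx H)^T = 1%:M.
Proof.
have sym : (reflection_mx H)^T = reflection_mx H.
  apply/matrixP => i j; have := dot_reflection H (delta_mx 0 j) (delta_mx 0 i).
  rewrite /dot -!mul_reflection_mx trmx_mul !mulmxA.
  by rewrite -!rowE trmx_delta -!colE !mxE.
rewrite sym; apply/row_matrixP => i.
by rewrite !rowE mulmxA !mul_reflection_mx reflectionK mulmx1.
Qed.

Lemma exists_unit_orthoc H : proper_subspace H ->
  exists2 e, e \in orthoc H & enorm e = 1.
Proof.
move=> /andP[d1 d2].
have : orthoc H != 0%VS.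
  apply/eqP => o0; have := addv_orthoc H; rewrite o0 add0v => Hf.
  by move: d1 d2; rewrite Hf dimvf /dim /= mul1n; lia.
move=> /eqP o0; have v0 : vpick (orthoc H) != 0 by rewrite vpick0; apply/eqP.
exists ((enorm (vpick (orthoc H)))^-1 *: vpick (orthoc H)).
  by rewrite memvZ ?memv_pick.
by rewrite enormZ ger0_norm ?invr_ge0 ?enorm_ge0 // mulVf ?gt_eqF ?enorm_gt0.
Qed.

Lemma hyperplane_orthoc_line H u v : hyperplane H -> u \in orthoc H -> v \in orthoc H ->
  v != 0 -> exists a, u = a *: v.
Proof.
move=> [/andP[d1 d2] dH] uH vH v0.
have d : \dim (orthoc H) = 1%N.
  have := dimv_disjoint_sum (capv_orthoc H).
  by rewrite addv_orthoc dimvf /dim /= mul1n dH; lia.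
have : (<[v]> == orthoc H)%VS by rewrite eqEdim -memvE vH dim_vline v0 d.
by move=> /eqP o; move: uH; rewrite -o => /vlineP[a ->]; exists a.
Qed.

Lemma proper_subspace_gt0 H : proper_subspace H -> (0 < n)%N.
Proof. by case/andP; lia. Qed.

End Reflections.

(** * Support functions and the Hausdorff distance *)

Section Bodies.
Context (R : realType) (n : nat).
Implicit Types (u v w x y z : 'rV[R]_n) (K L : set 'rV[R]_n).

Lemma convex_bodyP K : convex_body K <-> [/\ K !=set0, compact K &
  forall x y t, K x -> K y -> 0 <= t -> t <= 1 -> K (t *: x + (1 - t) *: y)].
Proof.
split=> -[K0 cK h]; split=> // x y.
- move=> t Kx Ky t0 t1.
  have ti : Itv.spec (@Itv.num_sem R) (Itv.Real `[0%Z, 1%Z]) t.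
    by apply/andP; split; [exact: num_real|rewrite in_itv/= t0 t1].
  have := h x y (Itv.mk ti); rewrite !inE /= => /(_ Kx Ky).
  by rewrite /conv /=.
- move=> l; rewrite !inE => Kx Ky.
  exact: (h x y l%:num Kx Ky (ge0 l) (le1 l)).
Qed.

Lemma body_bounded K : convex_body K -> exists2 D, 0 < D & forall y, K y -> enorm y <= D.
Proof.
case=> K0 /compact_bounded /ex_strict_bound_gt0[D D0 /= h] _.
exists (n%:R * D + 1) => [|y /h yD]; first by rewrite ltr_wpDl // mulr_ge0 // ltW.
by rewrite (le_trans (enorm_le_norm _)) // ler_wpDr // ler_wpM2l // ltW.
Qed.

Lemma compact_of_bounded K D : closed K -> (forall y, K y -> enorm y <= D) -> compact K.
Proof.
move=> cK KD; apply: bounded_closed_compact => //.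
exists D; split; first exact: num_real.
by move=> M DM y /KD yD /=; rewrite (le_trans (norm_le_enorm _)) // (le_trans yD) // ltW.
Qed.

(** The support function. Bodies are compared through it because inclusion and
    Hausdorff distance can be read off it on the unit sphere, while Minkowski
    symmetrization acts on it linearly. *)
Definition supp K x : R := sup [set dot x y | y in K].

Lemma supp_attained K x : convex_body K -> exists2 y, K y & supp K x = dot x y.
Proof.
move=> bK; have [K0 cK _] := bK.
have [|y Ky ymax] := @compact_EVT_max _ _ (dot x : 'rV[R]_n -> R^o) K K0 cK.
  by apply: continuous_subspaceT; exact: dot_continuous.
rewrite inE in Ky; exists y => //; apply/eqP; rewrite eq_le; apply/andP; split.
  apply: ge_sup; first by exists (dot x y), y.
  by move=> _ [z Kz <-]; apply: ymax; rewrite inE.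
apply: ub_le_sup; last by exists y.
by exists (dot x y) => _ [z Kz <-]; apply: ymax; rewrite inE.
Qed.

Lemma supp_ge K x y : convex_body K -> K y -> dot x y <= supp K x.
Proof.
move=> bK Ky; apply: ub_le_sup; last by exists y.
have [D D0 KD] := body_bounded bK.
exists (enorm x * D) => _ [z Kz <-].
by rewrite (le_trans (cauchy_schwarz _ _)) // ler_wpM2l ?enorm_ge0 ?KD.
Qed.

Lemma supp_le K x c : convex_body K -> (forall y, K y -> dot x y <= c) -> supp K x <= c.
Proof. by move=> bK h; have [y /h + ->] := supp_attained x bK. Qed.

Lemma supp_sub K L x : convex_body K -> convex_body L -> K `<=` L -> supp K x <= supp L x.
Proof. by move=> bK bL KL; apply: supp_le => // y /KL; exact: supp_ge. Qed.

Lemma suppZ K a x : convex_body K -> 0 <= a -> supp K (a *: x) = a * supp K x.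
Proof.
move=> bK a0; apply/eqP; rewrite eq_le; apply/andP; split.
  by apply: supp_le => // y Ky; rewrite dotZl ler_wpM2l ?supp_ge.
by have [y Ky ->] := supp_attained x bK; rewrite -dotZl supp_ge.
Qed.

Lemma supp_lip K D x y : convex_body K -> (forall z, K z -> enorm z <= D) ->
  supp K x <= supp K y + D * enorm (x - y).
Proof.
move=> bK KD; have [z Kz ->] := supp_attained x bK.
rewrite -{1}(subrK y x) dotDl addrC lerD ?supp_ge //.
by rewrite (le_trans (cauchy_schwarz _ _)) // mulrC ler_wpM2r ?enorm_ge0 ?KD.
Qed.

Lemma supp_bound K D x : convex_body K -> (forall z, K z -> enorm z <= D) ->
  `|supp K x| <= D * enorm x.
Proof.
move=> bK KD; have [z Kz ->] := supp_attained x bK.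
by rewrite (le_trans (cauchy_schwarz_abs _ _)) // mulrC ler_wpM2r ?enorm_ge0 ?KD.
Qed.

(** The segment from the nearest point of [L] to [z] is normal to [L], so a
    point farther than [e] from [L] is cut off by the halfspace normal to it. *)
Lemma parallel_body_supp L e z : convex_body L -> 0 <= e ->
  (forall u, enorm u = 1 -> dot u z <= supp L u + e) -> parallel_body L e z.
Proof.
move=> bL e0 hz; have [L0 cL cvL] := (convex_bodyP L).1 bL.
have [|y0 Ly0 ymin] := @compact_EVT_min _ _ (fun y => enorm (y - z) : R^o) L L0 cL.
  apply: continuous_subspaceT.
  apply: (@lipschitz_continuous _ _ _ _ 1) => x y; rewrite mul1r.
  by rewrite (le_trans (enorm_lip _ _)) // opprB addrA subrK.
rewrite inE in Ly0.
have [le|lt] := leP (enorm (z - y0)) e.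
  by exists y0 => //; exists (z - y0) => //; rewrite addrC subrK.
set v := z - y0 in lt.
have v0 : 0 < enorm v by apply: le_lt_trans lt.
have nrm y : L y -> dot v (y - y0) <= 0.
  move=> Ly; rewrite leNgt; apply/negP => c0.
  set d := y - y0 in c0; set c := dot v d in c0.
  have dd : 0 <= dot d d := dot_ge0 d.
  (* Moving from [y0] towards [y] by this fraction strictly decreases the distance. *)
  pose t := c / (dot d d + c).
  have s0 : 0 < dot d d + c by rewrite ltr_wpDl.
  have t0 : 0 < t by rewrite divr_gt0.
  have t1 : t <= 1 by rewrite ler_pdivrMr // mul1r lerDr.
  have /ymin : t *: y + (1 - t) *: y0 \in L by rewrite inE; apply: cvL => //; exact: ltW.
  have -> : t *: y + (1 - t) *: y0 - z = t *: d - v.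
    by rewrite scalerBl scale1r /d /v scalerBr opprB !addrA addrAC (addrAC (_ *: y)).
  rewrite (enormB y0) -/v -(ler_pXn2r (n:=2)) ?nnegrE ?enorm_ge0 //.
  rewrite !enorm_sqr; clearbody v d; rewrite !dot_lin (dotC d v) -/c.
  have tE : t * (dot d d + c) = c by rewrite /t divfK // gt_eqF.
  nra.
have uv : enorm ((enorm v)^-1 *: v) = 1.
  by rewrite enormZ ger0_norm ?invr_ge0 ?enorm_ge0 // mulVf ?gt_eqF.
have := hz _ uv; rewrite leNgt => /negP[].
have [y Ly ->] := supp_attained ((enorm v)^-1 *: v) bL.
rewrite !dotZl; apply: (@le_lt_trans _ _ ((enorm v)^-1 * dot v y0 + e)).
  by rewrite lerD2r ler_wpM2l ?invr_ge0 ?enorm_ge0 // -subr_le0 -dotBr nrm.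
rewrite -ltrBrDl -mulrBr -dotBr -/v -enorm_sqr expr2 mulrA mulVf ?mul1r //.
by rewrite gt_eqF.
Qed.

Lemma in_body_supp L z : convex_body L ->
  (forall u, enorm u = 1 -> dot u z <= supp L u) -> L z.
Proof.
move=> bL hz; have [|y Ly [w /= w0 <-]] := @parallel_body_supp L 0 z bL (lexx _).
  by move=> u u1; rewrite addr0 hz.
suff -> : w = 0 by rewrite addr0.
by apply: enorm_eq0; apply/eqP; rewrite eq_le w0 enorm_ge0.
Qed.

Lemma supp_parallel K L e u : convex_body K -> convex_body L ->
  K `<=` parallel_body L e -> enorm u = 1 -> supp K u <= supp L u + e.
Proof.
move=> bK bL KL u1; apply: supp_le => // _ /KL[y Ly [w /= we <-]].
rewrite dotDr lerD ?supp_ge // (le_trans (cauchy_schwarz _ _)) //.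
by rewrite u1 mul1r.
Qed.

Lemma hausdorff_dist_le K L e : convex_body K -> convex_body L -> 0 <= e ->
  (forall u, enorm u = 1 -> `|supp K u - supp L u| <= e) -> hausdorff_dist K L <= e.
Proof.
move=> bK bL e0 h; apply: ge_inf; first by exists 0 => z -[].
split=> // x xK; [apply: (parallel_body_supp bL e0)|apply: (parallel_body_supp bK e0)];
  move=> u u1; have := h _ u1; rewrite ler_norml => /andP[? ?].
  by have := supp_ge u bK xK; lra.
by have := supp_ge u bL xK; lra.
Qed.

Lemma supp_le_hausdorff_dist K L u : convex_body K -> convex_body L -> enorm u = 1 ->
  `|supp K u - supp L u| <= hausdorff_dist K L.
Proof.
move=> bK bL u1; apply: lb_le_inf.
  have [D D0 KD] := body_bounded bK; have [E E0 LE] := body_bounded bL.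
  exists (D + E); split; first by rewrite addr_ge0 ?ltW.
    move=> x Kx; apply: (parallel_body_supp bL) => [|v v1]; first by rewrite addr_ge0 ?ltW.
    have := supp_bound v bL LE; have := supp_bound v bK KD.
    by rewrite v1 !mulr1 !ler_norml; have := supp_ge v bK Kx; lra.
  move=> x Lx; apply: (parallel_body_supp bK) => [|v v1]; first by rewrite addr_ge0 ?ltW.
  have := supp_bound v bL LE; have := supp_bound v bK KD.
  by rewrite v1 !mulr1 !ler_norml; have := supp_ge v bL Lx; lra.
move=> e [e0 KL LK]; rewrite ler_norml.
have := supp_parallel bK bL KL u1; have := supp_parallel bL bK LK u1; lra.
Qed.

Definition uniformly_cauchy (h : nat -> 'rV[R]_n -> R) : Prop :=
  forall e, 0 < e -> exists N, forall m p u, (N <= m)%N -> (N <= p)%N -> enorm u = 1 ->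
    `|h m u - h p u| <= e.

End Bodies.

(** * Completeness of the space of convex bodies *)

Section Completeness.
Context (R : realType) (n : nat).
Implicit Types (u v w x y z : 'rV[R]_n) (K L : set 'rV[R]_n).

Lemma real_cauchy_cvg (a : nat -> R) :
  (forall e, 0 < e -> exists N, forall m p, (N <= m)%N -> (N <= p)%N -> `|a m - a p| <= e) ->
  exists l, forall e, 0 < e -> exists N, forall m, (N <= m)%N -> `|a m - l| <= e.
Proof.
move=> h; have /cauchy_cvgP ca : cauchy (a @ \oo).
  apply: cauchy_exP => e e0; have [N hN] := h (e / 2) (divr_gt0 e0 (ltr0n _ 2)).
  exists (a N); exists N => // m /= Nm; rewrite /ball /=.
  by apply: le_lt_trans (hN _ _ _ Nm) _ => //; rewrite ltr_pdivrMr // ltr_pMr // ltr1n.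
exists (lim (a @ \oo)) => e e0.
have /cvgrPdist_le /(_ e e0)[N _ hN] := ca.
by exists N => m Nm; rewrite distrC; exact: hN.
Qed.

(** Blaschke completeness: the limit is cut out by the limits of the support
    functions; that it is approximated by the bodies of the sequence rests on a
    cluster point of nearby points. *)
Lemma uniformly_cauchy_limit (K_ : nat -> set 'rV[R]_n) :
  (0 < n)%N ->
  (forall m, convex_body (K_ m)) -> uniformly_cauchy (fun m => supp (K_ m)) ->
  exists2 L, convex_body L & forall e, 0 < e -> exists N, forall m u, (N <= m)%N ->
    enorm u = 1 -> `|supp (K_ m) u - supp L u| <= e.
Proof.
move=> n0 bK cK.
have hex u : exists l, enorm u = 1 ->
    forall e, 0 < e -> exists N, forall m, (N <= m)%N -> `|supp (K_ m) u - l| <= e.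
  have [u1|u1] := pselect (enorm u = 1); last by exists 0.
  have [|l hl] := @real_cauchy_cvg (fun m => supp (K_ m) u); last by exists l.
  move=> e e0; have [N hN] := cK e e0; exists N => m p Nm Np; exact: hN.
have [h hh] := choice hex.
have hunif e : 0 < e -> exists N, forall m u, (N <= m)%N -> enorm u = 1 ->
    `|supp (K_ m) u - h u| <= e.
  move=> e0; have e2 : 0 < e / 2 by rewrite divr_gt0.
  have [N hN] := cK _ e2; exists N => m u Nm u1.
  have [N' hN'] := hh u u1 _ e2.
  have := hN m (maxn N N') u Nm (leq_maxl _ _) u1.
  have := hN' (maxn N N') (leq_maxr _ _).
  by rewrite !ler_norml; lra.
pose L : set 'rV[R]_n := [set y | forall u, enorm u = 1 -> dot u y <= h u].
have Lbd : exists D, forall y, L y -> enorm y <= D.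
  have [N hN] := hunif 1 ltr01; have [D D0 KD] := body_bounded (bK N).
  exists (D + 1) => y Ly; apply: enorm_le_of_dot => // v v1.
  have := Ly v v1; have := hN N v (leqnn _) v1; have := supp_bound v (bK N) KD.
  by rewrite v1 !ler_norml; lra.
have Lnear e m y : 0 < e -> (forall u, enorm u = 1 -> `|supp (K_ m) u - h u| <= e) ->
    K_ m y -> parallel_body L (2 * e) y.
  move=> e0 he Kmy.
  have [N hN] := hunif e e0.
  have near p : exists yp, (N <= p)%N -> K_ p yp /\ enorm (y - yp) <= 2 * e.
    have [Np|Np] := boolP (N <= p)%N; last by exists 0.
    have [||yp Kyp [w /= we yE]] := @parallel_body_supp _ _ (K_ p) (2 * e) y (bK p).
      by rewrite mulr_ge0 // ltW.
      move=> u u1; have := supp_ge u (bK m) Kmy; have := hN p u Np u1.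
      by have := he u u1; rewrite !ler_norml; lra.
    by exists yp => _; split=> //; rewrite -yE addrC addKr.
  (* The points [f p] of the later bodies stay near [y]; their cluster point is
     the point of [L] sought. *)
  have [f hf] := choice near.
  have cB : compact [set z : 'rV[R]_n | enorm z <= enorm y + 2 * e].
    apply: (@compact_of_bounded _ _ _ (enorm y + 2 * e)) => //.
    apply: (@closed_comp _ _ (@enorm R n : _ -> R^o) [set t | t <= enorm y + 2 * e]).
      by move=> z _; exact: enorm_continuous.
    exact: closed_le.
  have [|z [/= _ zcl]] := cB (f @ \oo) _.
    exists N => // p /= Np; have [_ fp] := hf p Np.
    rewrite -(subrK y (f p)) addrC (le_trans (enormD _ _)) // lerD2l.
    by rewrite enormB.
  have hz d : 0 < d -> forall M, exists2 p, (M <= p)%N & enorm (z - f p) <= d.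
    move=> d0 M; have d1 : 0 < d / (n%:R + 1) by rewrite divr_gt0 // ltr_wpDl.
    have [|_ [[p Mp <-] zp]] := zcl (f @` [set p | (M <= p)%N]) (ball z (d / (n%:R + 1))) _ (nbhsx_ballx _ _ d1).
      by exists M => // p /= Mp; exists p.
    exists p => //; move: zp; rewrite -ball_normE /= ltr_pdivlMr ?ltr_wpDl // => zp.
    apply: le_trans (enorm_le_norm _) _; apply: le_trans (ltW zp).
    by rewrite mulrC ler_wpM2l // lerDl.
  exists z.
    move=> u u1; apply/ler_addgt0Pr => d d0; have d2 : 0 < d / 2 by rewrite divr_gt0.
    have [M hM] := hunif _ d2.
    have [p] := hz _ d2 (maxn M N); rewrite geq_max => /andP[Mp Np] zp.
    have [Kp _] := hf p Np.
    have := supp_ge u (bK p) Kp; have := hM p u Mp u1.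
    have := cauchy_schwarz u (z - f p); rewrite u1 mul1r dotBr ler_norml.
    lra.
  exists (y - z); last by rewrite addrC subrK.
  apply/ler_addgt0Pr => d d0; have [p Np zp] := hz _ d0 N.
  have [_ yp] := hf p Np.
  rewrite (le_trans (enorm_triangle y (f p) z)) // lerD //.
  by rewrite enormB.
have bL : convex_body L.
  apply/convex_bodyP; split.
  - have [N hN] := hunif 1 ltr01; have [[y Ky] _ _] := bK N.
    have [z Lz _] := Lnear 1 N y ltr01 (fun u => hN N u (leqnn _)) Ky.
    by exists z.
  - have [D LD] := Lbd; apply: (@compact_of_bounded _ _ _ D) => //.
    have -> : L = \bigcap_(u in [set u | enorm u = 1]) [set y | dot u y <= h u].
      by apply/seteqP; split => y Ly u u1; exact: Ly.
    apply: closed_bigI => u _.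
    apply: (@closed_comp _ _ (dot u : _ -> R^o) [set t | t <= h u]).
      by move=> z _; exact: dot_continuous.
    exact: closed_le.
  - move=> x y t Lx Ly t0 t1 u u1; rewrite dotDr !dotZr.
    have := Lx u u1; have := Ly u u1; nra.
exists L => // e e0; have e2 : 0 < e / 2 by rewrite divr_gt0.
have [N hN] := hunif _ e2; exists N => m u Nm u1.
have /supp_parallel -/(_ _ (bK m) bL u1) h1 : K_ m `<=` parallel_body L (2 * (e / 2)).
  by move=> y; apply: Lnear => // v; exact: hN.
have h2 : supp L u <= h u by apply: supp_le => // y Ly; exact: Ly.
by have := hN m u Nm u1; rewrite !ler_norml; lra.
Qed.

Lemma hausdorff_cvgP (K_ : nat -> set 'rV[R]_n) : (0 < n)%N ->
  (forall m, convex_body (K_ m)) ->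
  hausdorff_cvg K_ <-> uniformly_cauchy (fun m => supp (K_ m)).
Proof.
move=> n0 bK; split=> [[L bL /cvgrPdist_le cL]|/(uniformly_cauchy_limit n0 bK)[L bL h]].
  move=> e e0; have [N _ hN] := cL (e / 2) (divr_gt0 e0 (ltr0n _ 2)).
  exists N => m p u Nm Np u1.
  have := supp_le_hausdorff_dist (bK m) bL u1; have := hN m Nm.
  have := supp_le_hausdorff_dist (bK p) bL u1; have := hN p Np.
  by rewrite /= !ler_norml; lra.
exists L => //; apply/cvgrPdist_le => e e0; have [N hN] := h e e0.
exists N => // m /= Nm; rewrite sub0r normrN ger0_norm.
  by apply: hausdorff_dist_le => //; [exact: ltW|move=> u; exact: hN].
have [u u1] := exists_unit R n0.
exact: le_trans (normr_ge0 _) (supp_le_hausdorff_dist (bK m) bL u1).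
Qed.

End Completeness.

(** * Constructions of convex bodies *)

Section BodyConstructions.
Context (R : realType) (n : nat).
Implicit Types (u v w x y z : 'rV[R]_n) (K L : set 'rV[R]_n) (H : {vspace 'rV[R]_n}).

(** The Minkowski sums, the Minkowski symmetrals and the fiber symmetrals are all
    images of compact convex sets of pairs under affine maps. *)
Lemma body_image2 (A : set ('rV[R]_n * 'rV[R]_n)) (f : 'rV[R]_n -> 'rV[R]_n -> 'rV[R]_n) c :
  A !=set0 -> compact A ->
  (forall p q t, A p -> A q -> 0 <= t -> t <= 1 -> A (t *: p + (1 - t) *: q)) ->
  (forall x y x' y', enorm (f x y - f x' y') <= c * (enorm (x - x') + enorm (y - y'))) ->
  (forall x y x' y' t, f (t *: x + (1 - t) *: x') (t *: y + (1 - t) *: y') =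
     t *: f x y + (1 - t) *: f x' y') ->
  convex_body ((fun p => f p.1 p.2) @` A).
Proof.
move=> [p0 Ap0] cA cvA flip faff; apply/convex_bodyP; split.
- by exists (f p0.1 p0.2), p0.
- apply: continuous_compact => //; apply: continuous_subspaceT => p.
  apply/(@cvgrPdist_lt _ _ _ (nbhs p) (nbhs_filter p)) => e e0.
  pose c' := (`|c| + 1) * (2 * (n%:R + 1)).
  have p1 : 0 < c' by rewrite !mulr_gt0 // ltr_wpDl.
  have d0 : 0 < e / c' by rewrite divr_gt0.
  have : nbhs p (ball p (e / c')) by exact: nbhsx_ballx.
  apply: (@filterS _ (nbhs p) (nbhs_filter p)) => q [].
  rewrite -!ball_normE /= !ltr_pdivlMr // => h1 h2.
  apply: le_lt_trans (norm_le_enorm _) _.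
  apply: le_lt_trans (flip _ _ _ _) _.
  apply: (@le_lt_trans _ _ ((`|c| + 1) * (enorm (p.1 - q.1) + enorm (p.2 - q.2)))).
    rewrite ler_wpM2r ?addr_ge0 ?enorm_ge0 // (le_trans (ler_norm _)) //.
    by rewrite lerDl.
  have hn x : enorm x <= (n%:R + 1) * `|x|.
    by rewrite (le_trans (enorm_le_norm _)) // ler_wpM2r // lerDl.
  have := hn (p.1 - q.1); have := hn (p.2 - q.2).
  move: h1 h2; rewrite /c'; have : 0 < `|c| + 1 by rewrite ltr_wpDl.
  move: (`|c| + 1) (n%:R + 1) => a b a0 h1 h2 h3 h4.
  have : a * enorm (p.1 - q.1) <= a * (b * `|p.1 - q.1|) by rewrite ler_wpM2l // ltW.
  have : a * enorm (p.2 - q.2) <= a * (b * `|p.2 - q.2|) by rewrite ler_wpM2l // ltW.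
  by nra.
- move=> _ _ t [p Ap <-] [q Aq <-] t0 t1.
  exists (t *: p + (1 - t) *: q); first exact: cvA.
  by rewrite -faff.
Qed.

Lemma body_image K (f : 'rV[R]_n -> 'rV[R]_n) c : convex_body K ->
  (forall x x', enorm (f x - f x') <= c * enorm (x - x')) ->
  (forall x x' t, f (t *: x + (1 - t) *: x') = t *: f x + (1 - t) *: f x') ->
  convex_body (f @` K).
Proof.
move=> /convex_bodyP[[x0 Kx0] cK cvK] flip faff.
have -> : f @` K = (fun p => f p.1) @` (K `*` [set (0 : 'rV[R]_n)]).
  apply/seteqP; split => _ [x Kx <-]; first by exists (x, 0).
  by exists x.1 => //; case: Kx.
apply: (@body_image2 _ (fun x _ => f x) `|c|).
- by exists (x0, 0).
- by apply: compact_setX => //; exact: compact_set1.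
- move=> p q t [p1 /= p2] [q1 /= q2] t0 t1; split => /=; first exact: cvK.
  by rewrite p2 q2 !scaler0 addr0.
- move=> x y x' y'; rewrite (le_trans (flip _ _)) // mulrDr ler_wpDr //.
    by rewrite mulr_ge0 ?enorm_ge0.
  by rewrite ler_wpM2r ?enorm_ge0 ?ler_norm.
- by move=> *; exact: faff.
Qed.

Lemma msumE K L : msum K L = (fun p => p.1 + p.2) @` (K `*` L).
Proof.
apply/seteqP; split => [_ [x Kx [y Ly <-]]|_ [[x y] [/= Kx Ly] <-]].
  by exists (x, y).
by exists x => //; exists y.
Qed.

Lemma convex_comboD t x y x' y' :
  (t *: x + (1 - t) *: x') + (t *: y + (1 - t) *: y') =
  t *: (x + y) + (1 - t) *: (x' + y') :> 'rV[R]_n.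
Proof. by rewrite addrACA -!scalerDr. Qed.

Lemma body_setX K L : convex_body K -> convex_body L ->
  [/\ (K `*` L) !=set0, compact (K `*` L) &
  forall p q t, (K `*` L) p -> (K `*` L) q -> 0 <= t -> t <= 1 ->
    (K `*` L) (t *: p + (1 - t) *: q)].
Proof.
move=> /convex_bodyP[[x0 Kx0] cK cvK] /convex_bodyP[[y0 Ly0] cL cvL]; split.
- by exists (x0, y0).
- exact: compact_setX.
- by move=> p q t [p1 p2] [q1 q2] t0 t1; split; [exact: cvK|exact: cvL].
Qed.

Lemma body_msum K L : convex_body K -> convex_body L -> convex_body (msum K L).
Proof.
move=> bK bL; have [h1 h2 h3] := body_setX bK bL; rewrite msumE.
apply: (@body_image2 _ (fun x y => x + y) 1) => //.
  by move=> x y x' y'; rewrite mul1r opprD addrACA enormD.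
by move=> x y x' y' t; rewrite convex_comboD.
Qed.

Lemma supp_msum K L x : convex_body K -> convex_body L ->
  supp (msum K L) x = supp K x + supp L x.
Proof.
move=> bK bL; have bKL := body_msum bK bL; apply/eqP; rewrite eq_le; apply/andP; split.
  by apply: supp_le => // _ [y Ky [z Lz <-]]; rewrite dotDr lerD ?supp_ge.
have [y Ky ->] := supp_attained x bK; have [z Lz ->] := supp_attained x bL.
by rewrite -dotDr supp_ge //; exists y => //; exists z.
Qed.

Definition eball (r : R) : set 'rV[R]_n := [set x | enorm x <= r].

Lemma closed_eball r : closed (eball r).
Proof.
apply: (@closed_comp _ _ (@enorm R n : _ -> R^o) [set t | t <= r]).
  by move=> z _; exact: enorm_continuous.
exact: closed_le.
Qed.

Lemma body_eball r : 0 <= r -> convex_body (eball r).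
Proof.
move=> r0; apply/convex_bodyP; split.
- by exists 0; rewrite /eball /= enorm0.
- by apply: (@compact_of_bounded _ _ _ r) => //; exact: closed_eball.
- move=> x y t; rewrite /eball /= => xr yr t0 t1.
  rewrite (le_trans (enormD _ _)) // !enormZ !ger0_norm ?subr_ge0 //.
  by have := enorm_ge0 x; have := enorm_ge0 y; nra.
Qed.

Lemma supp_eball r u : 0 <= r -> enorm u = 1 -> supp (eball r) u = r.
Proof.
move=> r0 u1; have bB := body_eball r0; apply/eqP; rewrite eq_le; apply/andP; split.
  by apply: supp_le => // y yr; rewrite (le_trans (cauchy_schwarz _ _)) // u1 mul1r.
have : eball r (r *: u) by rewrite /eball /= enormZ u1 mulr1 ger0_norm.
by move/(supp_ge u bB); rewrite dotZr -enorm_sqr u1 expr1n mulr1.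
Qed.

Lemma body_translate K x : convex_body K -> convex_body (translate x K).
Proof.
move=> bK; apply: (@body_image _ (fun y => y + x) 1) => //.
  by move=> y y'; rewrite mul1r opprD addrACA subrr addr0.
move=> y y' t; rewrite !scalerDr addrACA; congr (_ + _).
by rewrite -scalerDl addrC subrK scale1r.
Qed.

Lemma translate0 K : translate 0 K = K.
Proof.
apply/seteqP; split => [_ [y Ky <-]|y Ky]; first by rewrite addr0.
by exists y; rewrite ?addr0.
Qed.

Lemma orthogonal_dot (A : 'M[R]_n) x y : A *m A^T = 1%:M ->
  dot (x *m A) (y *m A) = dot x y.
Proof. by move=> AA; rewrite dot_mulmx -mulmxA AA mulmx1. Qed.

Lemma orthogonal_enorm (A : 'M[R]_n) x : A *m A^T = 1%:M -> enorm (x *m A) = enorm x.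
Proof. by move=> AA; rewrite /enorm orthogonal_dot. Qed.

Lemma orthogonal_trmx (A : 'M[R]_n) : A *m A^T = 1%:M -> A^T *m A^T^T = 1%:M.
Proof. by move=> /mulmx1C; rewrite trmxK. Qed.

Lemma body_rotate (A : 'M[R]_n) K : A *m A^T = 1%:M -> convex_body K ->
  convex_body (rotate A K).
Proof.
move=> AA bK; apply: (@body_image _ _ 1) => //.
  by move=> y y'; rewrite mul1r -mulmxBl orthogonal_enorm.
by move=> y y' t; rewrite mulmxDl -!scalemxAl.
Qed.

Lemma supp_rotate (A : 'M[R]_n) K u : A *m A^T = 1%:M -> convex_body K ->
  supp (rotate A K) u = supp K (u *m A^T).
Proof.
move=> AA bK; have bA := body_rotate AA bK; apply/eqP; rewrite eq_le; apply/andP; split.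
  by apply: supp_le => // _ [y Ky <-]; rewrite dotC dot_mulmx dotC supp_ge.
have [y Ky ->] := supp_attained (u *m A^T) bK.
by rewrite dotC -dot_mulmx dotC supp_ge //; exists y.
Qed.

Definition segment y z : set 'rV[R]_n :=
  [set t *: y + (1 - t) *: z | t in [set t : R | 0 <= t <= 1]].

Lemma body_segment y z : convex_body (segment y z).
Proof.
apply/convex_bodyP; split.
- by exists (1 *: y + (1 - 1) *: z), 1 => //=; rewrite ler01 lexx.
- have -> : segment y z = (fun t : R^o => t *: y + (1 - t) *: z) @` `[0, 1]%classic.
    by apply/seteqP; split => _ [t /= t01 <-]; exists t => //; rewrite /= in_itv in t01 *.
  apply: continuous_compact; last exact: segment_compact.
  apply: continuous_subspaceT => t; apply: cvgD; apply: cvgZr_tmp => //.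
  by apply: cvgB => //; exact: cvg_cst.
- move=> _ _ t [a /andP[a0 a1] <-] [b /andP[b0 b1] <-] t0 t1.
  exists (t * a + (1 - t) * b); first by apply/andP; split; nra.
  rewrite !scalerDr !scalerA addrACA -!scalerDl; congr (_ + _ *: _); ring.
Qed.

End BodyConstructions.

(** * Fiber and Minkowski symmetrization bound every member of the family *)

Section FamilyF.
Context (R : realType) (n : nat).
Implicit Types (u v w x y z : 'rV[R]_n) (K L : set 'rV[R]_n) (H : {vspace 'rV[R]_n}).
Implicit Types (S : set_operation R n).

Local Notation M := (@minkowski_symm R n).
Local Notation F := (@fiber_symm R n).

Lemma minkowskiP H K v : M H K v <->
  exists y z, [/\ K y, K z & v = 2^-1 *: (y + reflection H z)].
Proof.
split=> [[_ [y Ky [_ [z Kz <-] <-]] <-]|[y [z [Ky Kz ->]]]]; first by exists y, z.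
exists (y + reflection H z) => //; exists y => //; exists (reflection H z) => //.
Qed.

(** Two points lie in the same section exactly when their difference is in
    [orthoc H]; this removes the union over the base points of the sections. *)
Lemma fiberP H K v : F H K v <->
  exists y z, [/\ K y, K z, y - z \in orthoc H & v = 2^-1 *: (y + reflection H z)].
Proof.
split.
  move=> [x xH [_ [y [Ky [y' /= y'H yE]] [_ [z [Kz [z' /= z'H zE]] <-] <-]] <-]].
  exists y, z; split => //.
  by rewrite -yE -zE opprD addrACA subrr addr0 rpredB.
move=> [y [z [Ky Kz yz ->]]]; have Hy := sub_proj_orthoc_mem H y.
exists (y - proj_orthoc H y) => //.
exists (y + reflection H z) => //; exists y.
  by split => //; exists (proj_orthoc H y); rewrite /= ?proj_orthoc_mem // addrC subrK.
exists (reflection H z) => //; exists z => //; split => //.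
exists (z - (y - proj_orthoc H y)); last by rewrite subrK.
have -> : z - (y - proj_orthoc H y) = proj_orthoc H y - (y - z).
  by move: (proj_orthoc H y) => p; apply/rowP => j; rewrite !mxE; ring.
by rewrite /= rpredB ?proj_orthoc_mem.
Qed.

Lemma fiber_sub_minkowski H K : F H K `<=` M H K.
Proof. by move=> v /fiberP[y [z [Ky Kz _ vE]]]; apply/minkowskiP; exists y, z. Qed.

Lemma reflection_half H y z : reflection H (2^-1 *: (y + reflection H z)) =
  2^-1 *: (z + reflection H y).
Proof. by rewrite reflectionZ reflectionD reflectionK addrC. Qed.

Lemma half_lipschitz H y z y' z' :
  enorm (2^-1 *: (y + reflection H z) - 2^-1 *: (y' + reflection H z')) <=
  1 * (enorm (y - y') + enorm (z - z')).
Proof.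
rewrite -scalerBr opprD addrACA -reflectionB enormZ ger0_norm ?invr_ge0 //.
rewrite mul1r -(enorm_reflection H (z - z')).
have := enormD (y - y') (reflection H (z - z')).
have := enorm_ge0 (y - y' + reflection H (z - z')).
lra.
Qed.

Lemma half_affine H y z y' z' t :
  2^-1 *: ((t *: y + (1 - t) *: y') + reflection H (t *: z + (1 - t) *: z')) =
  t *: (2^-1 *: (y + reflection H z)) + (1 - t) *: (2^-1 *: (y' + reflection H z')).
Proof.
rewrite reflectionD !reflectionZ convex_comboD scalerDr !scalerA.
by rewrite mulrC (mulrC 2^-1 (1 - t)).
Qed.

Lemma body_minkowski H K : convex_body K -> convex_body (M H K).
Proof.
move=> bK; have [h1 h2 h3] := body_setX bK bK.
have -> : M H K = (fun p => 2^-1 *: (p.1 + reflection H p.2)) @` (K `*` K).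
  apply/seteqP; split => v.
    by move=> /minkowskiP[y [z [Ky Kz ->]]]; exists (y, z).
  by move=> [[y z] [/= Ky Kz] <-]; apply/minkowskiP; exists y, z.
apply: (@body_image2 _ _ _ (fun y z => 2^-1 *: (y + reflection H z)) 1) => //.
  exact: half_lipschitz.
exact: half_affine.
Qed.

Lemma supp_minkowski H K x : convex_body K ->
  supp (M H K) x = (supp K x + supp K (reflection H x)) / 2.
Proof.
move=> bK; have bM := body_minkowski H bK; apply/eqP; rewrite eq_le; apply/andP; split.
  apply: supp_le => // _ /minkowskiP[y [z [Ky Kz ->]]].
  rewrite dotZr dotDr -dot_reflection mulrC ler_wpM2r ?invr_ge0 //.
  by rewrite lerD ?supp_ge.
have [y Ky ->] := supp_attained x bK.
have [z Kz ->] := supp_attained (reflection H x) bK.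
have : M H K (2^-1 *: (y + reflection H z)) by apply/minkowskiP; exists y, z.
by move/(supp_ge x bM); rewrite dotZr dotDr -dot_reflection mulrC.
Qed.

Lemma closed_orthoc H : closed [set d | d \in orthoc H].
Proof.
have -> : [set d | d \in orthoc H] =
    (fun d => enorm (d - proj_orthoc H d) : R^o) @^-1` [set 0].
  apply/seteqP; split => d /=.
    by move=> dH; rewrite proj_orthoc_id // subrr enorm0.
  by move/enorm_eq0/eqP; rewrite subr_eq0 => /eqP ->; exact: proj_orthoc_mem.
apply: closed_comp; last exact: closed_eq.
move=> p _; apply: (@lipschitz_continuous _ _ _ _ 2) => x y.
rewrite (le_trans (enorm_lip _ _)) //.
have -> : x - proj_orthoc H x - (y - proj_orthoc H y) = x - y - proj_orthoc H (x - y).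
  rewrite proj_orthocB; move: (proj_orthoc H x) (proj_orthoc H y) => a b.
  by apply/rowP => j; rewrite !mxE; ring.
set d := x - y.
have hd : enorm (proj_orthoc H d) <= enorm d.
  rewrite -(ler_pXn2r (n:=2)) ?nnegrE ?enorm_ge0 // !enorm_sqr.
  by rewrite (dot_orthoc_decomposition H d) lerDr dot_ge0.
by rewrite (le_trans (enormD _ _)) // enormN mulr_natl mulr2n lerD2l.
Qed.

Lemma body_fiber H K : convex_body K -> convex_body (F H K).
Proof.
move=> bK; have [[p0 Kp0] cKK cvK] := body_setX bK bK.
pose A := (K `*` K) `&` [set p | p.1 - p.2 \in orthoc H].
have -> : F H K = (fun p => 2^-1 *: (p.1 + reflection H p.2)) @` A.
  apply/seteqP; split => v.
    by move=> /fiberP[y [z [Ky Kz yz ->]]]; exists (y, z).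
  by move=> [[y z] [[/= Ky Kz] yz] <-]; apply/fiberP; exists y, z.
apply: (@body_image2 _ _ _ (fun y z => 2^-1 *: (y + reflection H z)) 1).
- exists (p0.1, p0.1); case: Kp0 => Kp01 _; split => //=.
  by rewrite subrr mem0v.
- apply: compact_closedI => //.
  apply: (@closed_comp _ _ (fun p : 'rV[R]_n * 'rV[R]_n => p.1 - p.2)
    [set d | d \in orthoc H]); last exact: closed_orthoc.
  by move=> q _; apply: cvgB; [exact: cvg_fst|exact: cvg_snd].
- move=> p q t [Kp hp] [Kq hq] t0 t1; split; first exact: cvK.
  rewrite /=.
  have -> : t *: p.1 + (1 - t) *: q.1 - (t *: p.2 + (1 - t) *: q.2) =
     t *: (p.1 - p.2) + (1 - t) *: (q.1 - q.2).
    by rewrite !scalerBr opprD addrACA.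
  by rewrite rpredD // rpredZ.
- exact: half_lipschitz.
- exact: half_affine.
Qed.

Lemma refl_symmetricP H K : (forall v, K v -> K (reflection H v)) -> refl_symmetric H K.
Proof.
move=> h; apply/seteqP; split => [_ [v Kv <-]|v Kv]; first exact: h.
by exists (reflection H v); [exact: h|rewrite reflectionK].
Qed.

Lemma refl_symmetric_mem H K v : refl_symmetric H K -> K v -> K (reflection H v).
Proof. by move=> KE Kv; rewrite -KE; exists v. Qed.

Lemma minkowski_translate_sub H K x : convex_body K -> refl_symmetric H K ->
  x \in orthoc H -> M H (translate x K) `<=` K.
Proof.
move=> /convex_bodyP[_ _ cK] sK xH _ /minkowskiP[_ [_ [[y Ky <-] [z Kz <-] ->]]].
rewrite reflectionD (reflection_orthoc xH) addrACA subrr addr0.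
have -> : 2^-1 *: (y + reflection H z) = 2^-1 *: y + (1 - 2^-1) *: reflection H z.
  by rewrite scalerDr; congr (_ + _ *: _); field.
apply: cK => //; first exact: refl_symmetric_mem.
by rewrite invf_le1 // ler1n.
Qed.

(** A point [y] of a symmetric set is the average of [y + x] and of the
    reflection of [reflection H y + x]. *)
Lemma fiber_translate_sup H K x : refl_symmetric H K ->
  x \in orthoc H -> K `<=` F H (translate x K).
Proof.
move=> sK xH y Ky; apply/fiberP; exists (y + x), (reflection H y + x); split.
- by exists y.
- by exists (reflection H y) => //; exact: refl_symmetric_mem.
- by rewrite opprD addrACA subrr addr0 sub_reflection rpredZ ?proj_orthoc_mem.
- rewrite reflectionD reflectionK (reflection_orthoc xH) addrACA subrr addr0.
  have -> : y + y = 2 *: y by rewrite scaler_nat mulr2n.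
  by rewrite scalerA mulVf ?scale1r // pnatr_eq0.
Qed.

Lemma translation_invariant_invariant S : 
  translation_invariant_symm S -> invariant_symm S.
Proof.
move=> h H pH K bK sK; have := h H pH K bK sK 0 (mem0v _).
by rewrite translate0.
Qed.

Lemma familyF_minkowski : familyF M.
Proof.
have ti : translation_invariant_symm M.
  move=> H pH K bK sK x xH; apply/seteqP; split; first exact: minkowski_translate_sub.
  by apply: subset_trans (@fiber_sub_minkowski _ _); exact: fiber_translate_sup.
split=> //; last exact: translation_invariant_invariant.
  move=> H _ K bK; split; first exact: body_minkowski.
  apply: refl_symmetricP => _ /minkowskiP[y [z [Ky Kz ->]]].
  by rewrite reflection_half; apply/minkowskiP; exists z, y.
move=> H _ K L _ _ KL _ /minkowskiP[y [z [Ky Kz ->]]].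
by apply/minkowskiP; exists y, z; split => //; apply: KL.
Qed.

Lemma familyF_fiber : familyF F.
Proof.
have ti : translation_invariant_symm F.
  move=> H pH K bK sK x xH; apply/seteqP; split; last exact: fiber_translate_sup.
  by apply: subset_trans (@fiber_sub_minkowski _ _) _; exact: minkowski_translate_sub.
split=> //; last exact: translation_invariant_invariant.
  move=> H _ K bK; split; first exact: body_fiber.
  apply: refl_symmetricP => _ /fiberP[y [z [Ky Kz yz ->]]].
  rewrite reflection_half; apply/fiberP; exists z, y; split => //.
  by rewrite -opprB rpredN.
move=> H _ K L _ _ KL _ /fiberP[y [z [Ky Kz yz ->]]].
by apply/fiberP; exists y, z; split => //; apply: KL.
Qed.

(** A segment with direction in [orthoc H] is a translate along [orthoc H] of a
    symmetric one, so every member of the family must centre it. *)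
Lemma fiber_sub_familyF S H K : familyF S -> proper_subspace H -> convex_body K ->
  F H K `<=` S H K.
Proof.
move=> [_ mS tS _] pH bK _ /fiberP[y [z [Ky Kz yz ->]]].
set c := 2^-1 *: (y + reflection H z).
(* The segment from [y] to [z] is the symmetric segment from [c] to
   [reflection H c], moved by [x]. *)
pose x := proj_orthoc H (2^-1 *: (y + z)).
have bC := body_segment c (reflection H c).
have sC : refl_symmetric H (segment c (reflection H c)).
  apply: refl_symmetricP => _ [t /= /andP[t0 t1] <-].
  exists (1 - t); first by rewrite /=; apply/andP; split; lra.
  by rewrite reflectionD !reflectionZ reflectionK subKr addrC.
have Pyz : y - z = proj_orthoc H y - proj_orthoc H z.
  by rewrite -proj_orthocB proj_orthoc_id.
have cx : c + x = y.
  rewrite /c /x /reflection proj_orthocZ proj_orthocD -scalerDr.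
  have -> : y + (z - 2 *: proj_orthoc H z) + (proj_orthoc H y + proj_orthoc H z) =
    y + z + (proj_orthoc H y - proj_orthoc H z).
    by apply/rowP => j; rewrite !mxE; ring.
  by rewrite -Pyz; apply/rowP => j; rewrite !mxE; field.
have cx' : reflection H c + x = z.
  rewrite reflection_half /x /reflection proj_orthocZ proj_orthocD -scalerDr.
  have -> : z + (y - 2 *: proj_orthoc H y) + (proj_orthoc H y + proj_orthoc H z) =
    y + z - (proj_orthoc H y - proj_orthoc H z).
    by apply/rowP => j; rewrite !mxE; ring.
  by rewrite -Pyz; apply/rowP => j; rewrite !mxE; field.
have xH : x \in orthoc H by exact: proj_orthoc_mem.
have sub : translate x (segment c (reflection H c)) `<=` K.
  move=> _ [_ [t /= /andP[t0 t1] <-] <-].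
  have -> : t *: c + (1 - t) *: reflection H c + x = t *: y + (1 - t) *: z.
    by rewrite -cx -cx'; apply/rowP => j; rewrite !mxE; ring.
  by case/convex_bodyP: bK => _ _; apply.
apply: (mS H pH _ _ (body_translate x bC) bK sub).
rewrite (tS H pH _ bC sC x xH).
by exists 1; rewrite /= ?ler01 ?lexx // subrr scale1r scale0r addr0.
Qed.

(** The slab between the supporting hyperplanes of [K] with normals [u] and
    [reflection H u] becomes symmetric after a translation along [orthoc H]; cut
    by a large ball, it bounds the image of [K] in the direction [u]. *)
Lemma familyF_sub_minkowski S H K : familyF S -> proper_subspace H -> convex_body K ->
  S H K `<=` M H K.
Proof.
move=> [_ mS tS _] pH bK v Sv.
apply: in_body_supp => [|u u1]; first exact: body_minkowski.
rewrite supp_minkowski //; set a := supp K u; set b := supp K (reflection H u).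
(* [t] is chosen along [p] with [dot u t = c]; if [p = 0] then [c = 0] as well,
   and the division by zero is harmless. *)
pose p := proj_orthoc H u; pose c := (a - b) / 2.
pose t := (c / dot p p) *: p.
have tH : t \in orthoc H by rewrite rpredZ ?proj_orthoc_mem.
have tu : dot u t = c.
  have up : dot u p = dot p p.
    by rewrite /p [RHS]dot_proj_orthoc (proj_orthoc_id (proj_orthoc_mem _ _)).
  rewrite /t dotZr up.
  have [p0|p0] := eqVneq (dot p p) 0; last by rewrite divfK.
  rewrite p0 mulr0 /c; have pz : p = 0 by exact: dot_eq0.
  have : reflection H u = u by rewrite /reflection -/p pz scaler0 subr0.
  by rewrite /a /b => ->; rewrite subrr mul0r.
have [D D0 KD] := body_bounded bK.
pose m := (a + b) / 2; pose E := D + enorm t.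
pose C : set 'rV[R]_n := [set x | [/\ dot u x <= m, dot (reflection H u) x <= m & enorm x <= E]].
have KC y : K y -> C (y - t).
  move=> Ky; split.
  - by rewrite dotBr tu; have := supp_ge u bK Ky; rewrite -/a /c /m; lra.
  - rewrite dotBr [X in _ - X]dot_reflection (reflection_orthoc tH) dotNr tu.
    by have := supp_ge (reflection H u) bK Ky; rewrite -/b /c /m; lra.
  - by rewrite (le_trans (enormD _ _)) // enormN lerD2r KD.
have bC : convex_body C.
  apply/convex_bodyP; split.
  - by case: bK => -[y /KC Cy] _ _; exists (y - t).
  - apply: (@compact_of_bounded _ _ _ E) => [|y []//].
    have -> : C = [set x | dot u x <= m] `&` ([set x | dot (reflection H u) x <= m] `&` eball E).
      by apply/seteqP; split => [x [? ? ?]|x [? [? ?]]].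
    have cl w : closed [set x | dot w x <= m].
      apply: (@closed_comp _ _ (dot w : _ -> R^o) [set s | s <= m]).
        by move=> z _; exact: dot_continuous.
      exact: closed_le.
    by apply: closedI => //; apply: closedI => //; exact: closed_eball.
  - move=> x y s [x1 x2 x3] [y1 y2 y3] s0 s1; split; rewrite ?dotDr ?dotZr; [nra|nra|].
    rewrite (le_trans (enormD _ _)) // !enormZ !ger0_norm ?subr_ge0 //.
    by have := enorm_ge0 x; have := enorm_ge0 y; nra.
have sC : refl_symmetric H C.
  apply: refl_symmetricP => x [x1 x2 x3]; split.
  - by rewrite -dot_reflection.
  - by rewrite dot_reflection reflectionK.
  - by rewrite enorm_reflection.
have Ksub : K `<=` translate t C.
  by move=> y /KC Cy; exists (y - t) => //; rewrite subrK.
have := mS H pH K _ bK (body_translate t bC) Ksub v Sv.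
by rewrite (tS H pH _ bC sC t tH) => -[].
Qed.

End FamilyF.

(** * Iterated symmetrizations *)

Section Processes.
Context (R : realType) (n : nat).
Implicit Types (u v w x y z : 'rV[R]_n) (K L X Y : set 'rV[R]_n) (H : {vspace 'rV[R]_n}).
Implicit Types (S T : set_operation R n) (Hs : seq {vspace 'rV[R]_n}).

Local Notation M := (@minkowski_symm R n).
Local Notation F := (@fiber_symm R n).

Definition process S Hs K := foldl (fun L G => S G L) K Hs.

Lemma process_rcons S Hs H K : process S (rcons Hs H) K = S H (process S Hs K).
Proof. by rewrite /process -cats1 foldl_cat. Qed.

Lemma process_cat S Hs Hs' K : process S (Hs ++ Hs') K = process S Hs' (process S Hs K).
Proof. exact: foldl_cat. Qed.

Definition all_proper Hs := forall H, H \in Hs -> proper_subspace H.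

Lemma all_proper_rcons Hs H : all_proper (rcons Hs H) ->
  all_proper Hs /\ proper_subspace H.
Proof.
move=> h; split=> [G GH|]; apply: h; rewrite mem_rcons inE ?GH ?orbT //.
by rewrite eqxx.
Qed.

Lemma body_process S Hs K : familyF S -> all_proper Hs -> convex_body K ->
  convex_body (process S Hs K).
Proof.
move=> [sS _ _ _] + bK; elim/last_ind: Hs => [//|Hs H IH] /all_proper_rcons[/IH bP pH].
by rewrite process_rcons; case: (sS H pH _ bP).
Qed.

Lemma body_process_minkowski Hs K : convex_body K -> convex_body (process M Hs K).
Proof.
by elim/last_ind: Hs => // Hs H IH bK; rewrite process_rcons; apply: body_minkowski; exact: IH.
Qed.

Lemma minkowski_monotone H K L : K `<=` L -> M H K `<=` M H L.
Proof.
move=> KL _ /minkowskiP[y [z [Ky Kz ->]]].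
by apply/minkowskiP; exists y, z; split=> //; exact: KL.
Qed.

Lemma process_minkowski_monotone Hs K L : K `<=` L -> process M Hs K `<=` process M Hs L.
Proof.
elim/last_ind: Hs => // Hs H IH /IH h; rewrite !process_rcons; exact: minkowski_monotone.
Qed.

Lemma process_sub_minkowski S Hs K : familyF S -> all_proper Hs -> convex_body K ->
  process S Hs K `<=` process M Hs K.
Proof.
move=> fS + bK; elim/last_ind: Hs => [_ x //|Hs H IH /all_proper_rcons[pHs pH]].
have bP := body_process fS pHs bK; rewrite !process_rcons.
apply: subset_trans (familyF_sub_minkowski fS pH bP) _.
exact: minkowski_monotone (IH pHs).
Qed.

Lemma process_bounded S Hs K D : familyF S -> all_proper Hs -> convex_body K ->
  (forall y, K y -> enorm y <= D) -> forall y, process S Hs K y -> enorm y <= D.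
Proof.
move=> fS pHs bK KD y /(process_sub_minkowski fS pHs bK).
elim/last_ind: Hs y {pHs} => [|Hs H IH] y; first exact: KD.
rewrite process_rcons => /minkowskiP[y1 [y2 [/IH h1 /IH h2 ->]]].
rewrite enormZ ger0_norm ?invr_ge0 //.
have := enormD y1 (reflection H y2); rewrite enorm_reflection; lra.
Qed.

Lemma supp_process_minkowski_rcons Hs H K x : convex_body K ->
  supp (process M (rcons Hs H) K) x =
  (supp (process M Hs K) x + supp (process M Hs K) (reflection H x)) / 2.
Proof. by move=> bK; rewrite process_rcons supp_minkowski //; exact: body_process_minkowski. Qed.

Lemma successiveE S (H_ : nat -> {vspace 'rV[R]_n}) k m K :
  successive S H_ k m K = process S [seq H_ i | i <- index_iota k m.+1] K.
Proof.
rewrite /successive /process; move: (index_iota _ _) => s.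
by elim: s K => //= i s IH K; rewrite IH.
Qed.

Lemma all_proper_map (H_ : nat -> {vspace 'rV[R]_n}) s :
  (forall m, proper_subspace (H_ m)) -> all_proper [seq H_ i | i <- s].
Proof. by move=> h _ /mapP[i _ ->]. Qed.

Lemma index_iota_cat (a b c : nat) : (a <= b)%N -> (b <= c)%N ->
  index_iota a c = index_iota a b ++ index_iota b c.
Proof.
move=> ab bc; rewrite /index_iota; have -> : (c - a = (b - a) + (c - b))%N by lia.
by rewrite iotaD subnKC.
Qed.

Lemma successive_cat S (H_ : nat -> {vspace 'rV[R]_n}) k j m K :
  (k <= j.+1)%N -> (j <= m)%N ->
  successive S H_ k m K = successive S H_ j.+1 m (successive S H_ k j K).
Proof.
by move=> kj jm; rewrite !successiveE -process_cat -map_cat -index_iota_cat.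
Qed.

(** In direction [orthoc H], which is a line, averaging a section with its
    reflection amounts to centring a segment of the same length. *)
Lemma steiner_fiber H K : hyperplane H -> convex_body K ->
  steiner_symm H K = fiber_symm H K.
Proof.
move=> hH bK; have [_ cK cvK] := (convex_bodyP K).1 bK.
have [D D0 KD] := body_bounded bK.
have sec x y : fiber_section H x K y <-> K y /\ y - x \in orthoc H.
  split=> [[Ky [w wH wE]]|[Ky yx]]; first by split; rewrite // -wE addrK.
  by split=> //; exists (y - x); rewrite ?subrK.
have halfE y z x : x \in H -> y - x \in orthoc H -> z - x \in orthoc H ->
    2^-1 *: (y + reflection H z) = x + 2^-1 *: (y - z).
  move=> xH yx zx; rewrite -{1}(subrK x z) reflectionD (reflection_sub xH).
  rewrite (reflection_orthoc zx); apply/rowP => j.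
  by rewrite !mxE; field.
have lenP x : has_ubound [set enorm (y - z) | y in fiber_section H x K & z in fiber_section H x K].
  exists (D + D) => _ [y1 [Ky1 _] [y2 [Ky2 _] <-]].
  by rewrite (le_trans (enormD _ _)) // enormN lerD // KD.
apply/seteqP; split => v.
  move=> [x [xH [s0 Ss0]] [vx vlen]]; apply/fiberP.
  pose A := K `&` [set y | y - x \in orthoc H].
  have cA : compact A.
    apply: compact_closedI => //.
    apply: (@closed_comp _ _ (fun y : 'rV[R]_n => y - x) [set d | d \in orthoc H]).
      move=> y _; apply: (@lipschitz_continuous _ _ _ _ 1) => y1 y2.
      by rewrite mul1r opprD addrACA subrr addr0 norm_le_enorm.
    exact: closed_orthoc.
  have As0 : A s0 by apply/sec.
  have [|||[y0 z0]] := @compact_EVT_max _ R (fun p : 'rV[R]_n * 'rV[R]_n => enorm (p.1 - p.2)) (A `*` A).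
  - by exists (s0, s0).
  - exact: compact_setX.
  - apply: continuous_subspaceT => p.
    apply: (@continuous_comp _ _ _ (fun p : 'rV[R]_n * 'rV[R]_n => p.1 - p.2) (@enorm R n : _ -> R^o)).
      by apply: cvgB; [exact: cvg_fst|exact: cvg_snd].
    exact: enorm_continuous.
  rewrite inE => -[/= [Ky0 y0x] [Kz0 z0x]] pmax.
  have vd : enorm (v - x) <= enorm (y0 - z0) / 2.
    apply: le_trans vlen _; rewrite ler_wpM2r ?invr_ge0 //.
    apply: ge_sup; first by exists (enorm (s0 - s0)); exists s0 => //; exists s0.
    by move=> _ [y /sec Sy [z /sec Sz <-]]; apply: (pmax (y, z)); rewrite inE.
  have yz : y0 - z0 \in orthoc H.
    have -> : y0 - z0 = (y0 - x) - (z0 - x) by rewrite opprB addrA subrK.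
    exact: rpredB.
  have [a va a2] : exists2 a, v - x = a *: (y0 - z0) & `|a| <= 2^-1.
    have [e0|n0] := eqVneq (y0 - z0) 0.
      exists 0; last by rewrite normr0 invr_ge0.
      rewrite scale0r; apply: enorm_eq0; apply/eqP.
      by rewrite eq_le enorm_ge0 andbT (le_trans vd) // e0 enorm0 mul0r.
    have [a va] := hyperplane_orthoc_line hH vx yz n0.
    exists a => //; move: vd; rewrite va enormZ mulrC ler_pM2l //.
    exact: enorm_gt0.
  have [a1 a3] : - 2^-1 <= a /\ a <= 2^-1 by apply/andP; rewrite -ler_norml.
  pose comb t : 'rV[R]_n := t *: y0 + (1 - t) *: z0.
  have Kc t : 0 <= t -> t <= 1 -> K (comb t) by move=> *; exact: cvK.
  have cx t : comb t - x \in orthoc H.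
    have -> : comb t - x = t *: (y0 - x) + (1 - t) *: (z0 - x).
      by apply/rowP => j; rewrite !mxE; ring.
    by rewrite rpredD // rpredZ.
  (* Two points placed symmetrically about the midpoint of the longest chord,
     at distance [2 * enorm (v - x)] of each other. *)
  exists (comb (2^-1 + a)), (comb (2^-1 - a)).
  have cc : comb (2^-1 + a) - comb (2^-1 - a) = 2 *: (v - x).
    by rewrite va; apply/rowP => j; rewrite !mxE; ring.
  split.
  - by apply: Kc; lra.
  - by apply: Kc; lra.
  - by rewrite cc rpredZ.
  - by rewrite (halfE _ _ x) // cc scalerA mulVf ?pnatr_eq0 // scale1r addrC subrK.
move=> /fiberP[y [z [Ky Kz yz ->]]].
pose x := y - proj_orthoc H y.
have xH : x \in H := sub_proj_orthoc_mem H y.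
have yx : y - x \in orthoc H by rewrite /x subKr proj_orthoc_mem.
have zx : z - x \in orthoc H.
  have -> : z - x = (y - x) - (y - z) by apply/rowP => j; rewrite !mxE; ring.
  exact: rpredB.
exists x; first by split=> //; exists y; apply/sec.
rewrite /= (halfE _ _ x) // addrC addKr; split; first exact: rpredZ.
rewrite enormZ ger0_norm ?invr_ge0 // mulrC ler_wpM2r ?invr_ge0 //.
apply: ub_le_sup; first exact: lenP.
by exists y; [apply/sec|exists z => //; apply/sec].
Qed.

Lemma process_steiner_fiber Hs K : (forall H, H \in Hs -> hyperplane H) -> convex_body K ->
  process (@steiner_symm R n) Hs K = process F Hs K.
Proof.
move=> + bK; elim/last_ind: Hs => // Hs H IH hHs.
have hHs' G : G \in Hs -> hyperplane G by move=> GH; apply: hHs; rewrite mem_rcons inE GH orbT.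
have hH : hyperplane H by apply: hHs; rewrite mem_rcons inE eqxx.
rewrite !process_rcons IH // steiner_fiber //.
by apply: body_process => //; [exact: familyF_fiber|move=> G /hHs'[]].
Qed.

End Processes.

(** * From Minkowski symmetrization to the whole family *)

Section MinkowskiToFamily.
Context (R : realType) (n : nat).
Implicit Types (u v w x y z : 'rV[R]_n) (K L X Y : set 'rV[R]_n) (H : {vspace 'rV[R]_n}).
Implicit Types (S T : set_operation R n) (Hs : seq {vspace 'rV[R]_n}) (xs : seq 'rV[R]_n).

Local Notation M := (@minkowski_symm R n).

Lemma compact_net (A : set 'rV[R]_n) (d : R) : compact A -> 0 < d ->
  exists2 xs : seq 'rV[R]_n, (forall x, x \in xs -> A x) &
    forall x, A x -> exists2 y, y \in xs & enorm (x - y) <= d.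
Proof.
move=> cA d0; have d1 : 0 < d / (n%:R + 1) by rewrite divr_gt0 // ltr_wpDl.
have := cA; rewrite compact_cover => /(_ 'rV[R]_n A (fun x => (ball x (d / (n%:R + 1)))^°%classic)).
case=> [x _||D' D'A Acov]; first exact: open_interior.
  move=> x Ax; exists x => //; exact: (nbhsx_ballx x _ d1).
exists (finmap.enum_fset D').
  by move=> x xD; have := D'A x xD; rewrite inE.
move=> x /Acov[y /= yD /interior_subset]; rewrite -ball_normE /= => yx.
exists y => //; rewrite enormB (le_trans (enorm_le_norm _)) //.
move: yx; rewrite ltr_pdivlMr ?ltr_wpDl // => /ltW; apply: le_trans.
by rewrite mulrC ler_wpM2l // lerDl.
Qed.

Lemma compact_sphere : compact [set x : 'rV[R]_n | enorm x = 1].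
Proof.
apply: (@compact_of_bounded _ _ _ 1); last by move=> y /= ->.
apply: (@closed_comp _ _ (@enorm R n : _ -> R^o) [set 1]); last exact: closed_eq.
by move=> z _; exact: enorm_continuous.
Qed.

(** A substitute for the mean width: summing the gap between two bodies over a
    rotated copy of a fixed net of directions. *)
Definition net_gap xs X Y (g : 'M[R]_n) : R :=
  \sum_(x <- xs) (supp Y (x *m g) - supp X (x *m g)).

(** Some point of the rotated net is close to a direction where the gap is
    large, whatever the rotation. *)
Lemma net_gap_lower_bound (D c : R) : 0 < D -> 0 < c -> exists2 xs : seq 'rV[R]_n,
  (forall x, x \in xs -> enorm x = 1) &
  forall X Y, convex_body X -> convex_body Y -> X `<=` Y ->
    (forall y, Y y -> enorm y <= D) ->
    forall x0, enorm x0 = 1 -> c <= supp Y x0 - supp X x0 ->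
    forall g : 'M[R]_n, g *m g^T = 1%:M -> c / 2 <= net_gap xs X Y g.
Proof.
move=> D0 c0; have d0 : 0 < c / (4 * D) by rewrite divr_gt0 ?mulr_gt0.
have [xs xs1 xsnet] := compact_net compact_sphere d0.
exists xs => // X Y bX bY XY YD x0 x01 gap g gg.
have XD y : X y -> enorm y <= D by move=> /XY /YD.
have gT := orthogonal_trmx gg.
have [|y yxs dy] := xsnet (x0 *m g^T); first by rewrite /= orthogonal_enorm.
have dyg : enorm (x0 - y *m g) <= c / (4 * D).
  rewrite -(orthogonal_enorm _ gT) mulmxBl -mulmxA gg mulmx1 //.
have big : c / 2 <= supp Y (y *m g) - supp X (y *m g).
  have h1 := supp_lip x0 (y *m g) bY YD.
  have h2 := supp_lip (y *m g) x0 bX XD; rewrite (enormB _ x0) in h2.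
  have : D * enorm (x0 - y *m g) <= c / 4.
    rewrite (le_trans (ler_wpM2l (ltW D0) dyg)) // invfM mulrCA [D * _]mulrC.
    by rewrite -!mulrA mulVf ?gt_eqF // mulr1.
  by lra.
rewrite /net_gap (big_rem y) //= (le_trans big) // lerDl.
by apply: sumr_ge0 => x _; rewrite subr_ge0; exact: supp_sub.
Qed.

(** Minkowski symmetrization averages the gap over two rotated nets. *)
Lemma net_gap_minkowski xs X Y c Hs : convex_body X -> convex_body Y ->
  (forall g : 'M[R]_n, g *m g^T = 1%:M -> c <= net_gap xs X Y g) ->
  forall g : 'M[R]_n, g *m g^T = 1%:M ->
    c <= net_gap xs (process M Hs X) (process M Hs Y) g.
Proof.
move=> bX bY h; elim/last_ind: Hs => // Hs H IH g gg.
have -> : net_gap xs (process M (rcons Hs H) X) (process M (rcons Hs H) Y) g =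
  2^-1 * (net_gap xs (process M Hs X) (process M Hs Y) g +
   net_gap xs (process M Hs X) (process M Hs Y) (g *m reflection_mx H)).
  rewrite /net_gap -big_split mulr_sumr; apply: eq_bigr => x _ /=.
  by rewrite !supp_process_minkowski_rcons // mulmxA mul_reflection_mx; lra.
have := IH g gg.
have := IH (g *m reflection_mx H); rewrite trmx_mul mulmxA -(mulmxA g).
by rewrite reflection_mx_orthogonal mulmx1 => /(_ gg); lra.
Qed.

(** Convergence is replaced by a Cauchy condition, so that no limit body has to be
    carried around. *)
Lemma shape_stable_withP S (H_ : nat -> {vspace 'rV[R]_n}) A_ :
  (forall m, proper_subspace (H_ m)) -> familyF S ->
  shape_stable_with S H_ A_ <-> (forall m, rotation (A_ m)) /\
  (forall k K, convex_body K ->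
     uniformly_cauchy (fun m => supp (rotate (A_ m) (successive S H_ k m K)))).
Proof.
move=> pH fS; have n0 := proper_subspace_gt0 (pH 0%N).
have hb k K m : convex_body K -> rotation (A_ m) ->
    convex_body (rotate (A_ m) (successive S H_ k m K)).
  move=> bK [AA _]; apply: body_rotate => //; rewrite successiveE.
  by apply: body_process => //; exact: all_proper_map.
split=> -[rA h]; split=> // k K bK; have := h k K bK;
  by move/(hausdorff_cvgP n0 (fun m => hb k K m bK (rA m))).
Qed.

(** Let [Km m] be the [T]-process and [Y j m] the Minkowski process started at
    [Km j]: then [Km m] is contained in [Y j m], and [Y j m] decreases in [j].
    The limits in [m] of the rotated [Y j m] hence stabilise for large [j]; since
    Minkowski symmetrization does not shrink net gaps, [Km m] must be close to
    [Y j m], which converges after rotation. *)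
Theorem minkowski_stable_familyF T (H_ : nat -> {vspace 'rV[R]_n}) A_ :
  (forall m, proper_subspace (H_ m)) -> familyF T ->
  shape_stable_with M H_ A_ -> shape_stable_with T H_ A_.
Proof.
move=> pH fT /(shape_stable_withP A_ pH (familyF_minkowski R n))[rA sM].
apply/(shape_stable_withP A_ pH fT); split=> // k K bK.
have AA m : A_ m *m (A_ m)^T = 1%:M by case: (rA m).
have AT m := orthogonal_trmx (AA m).
have [D D0 KD] := body_bounded bK.
pose Km j := successive T H_ k j K.
pose Y j m := successive M H_ j.+1 m (Km j).
have bKm j : convex_body (Km j).
  by rewrite /Km successiveE; apply: body_process => //; exact: all_proper_map.
have KmD j y : Km j y -> enorm y <= D.
  rewrite /Km successiveE; apply: process_bounded => //; exact: all_proper_map.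
have bY j m : convex_body (Y j m).
  by rewrite /Y successiveE; exact: body_process_minkowski.
have YD j m y : Y j m y -> enorm y <= D.
  rewrite /Y successiveE; apply: process_bounded => //; last exact: KmD.
    exact: familyF_minkowski.
  exact: all_proper_map.
have KmY j m : (k <= j)%N -> (j <= m)%N -> Km m `<=` Y j m.
  move=> kj jm.
  have -> : Km m = process T [seq H_ i | i <- index_iota j.+1 m.+1] (Km j).
    by rewrite -successiveE -successive_cat // leqW.
  rewrite /Y successiveE; apply: process_sub_minkowski => //; exact: all_proper_map.
have Ycat j m l : (j <= m)%N -> (m <= l)%N -> Y j l = successive M H_ m.+1 l (Y j m).
  by move=> jm ml; rewrite /Y (@successive_cat _ _ M _ _ m).
have Ymono j m l : (k <= j)%N -> (j <= m)%N -> (m <= l)%N -> Y m l `<=` Y j l.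
  move=> kj jm ml; rewrite (Ycat j m l) // {1}/Y !(successiveE _ _ m.+1).
  by apply: process_minkowski_monotone; exact: KmY.
move=> e e0; pose c := e / 3; have c0 : 0 < c by rewrite divr_gt0.
have [xs xs1 hgap] := net_gap_lower_bound D0 c0.
pose s j m := \sum_(x <- xs) supp (rotate (A_ m) (Y j m)) x.
have s_cauchy j d : 0 < d -> exists N, forall m p, (N <= m)%N -> (N <= p)%N ->
    `|s j m - s j p| <= d.
  move=> d0; have sz : 0 < (size xs)%:R + 1 :> R by rewrite ltr_wpDl.
  have [N hN] := sM j.+1 (Km j) (bKm j) _ (divr_gt0 d0 sz).
  exists N => m p Nm Np; rewrite /s -sumrB.
  apply: le_trans (ler_norm_sum _ _ _) _.
  apply: (@le_trans _ _ (\sum_(x <- xs) (d / ((size xs)%:R + 1)))).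
    rewrite big_seq [leRHS]big_seq; apply: ler_sum => x /xs1 x1; exact: hN.
  rewrite big_const_seq count_predT iter_addr_0 -[leLHS]mulr_natl mulrCA.
  by rewrite ler_piMr ?(ltW d0) // ler_pdivrMr // mul1r lerDl.
have hsig j : exists l, forall d, 0 < d -> exists N, forall m, (N <= m)%N -> `|s j m - l| <= d.
  by apply: real_cauchy_cvg => d; exact: s_cauchy.
have [sig hs] := choice hsig.
have sig_lb j : - ((size xs)%:R * D) - 1 <= sig j.
  have [N hN] := hs j 1 ltr01; have := hN N (leqnn _).
  suff : - ((size xs)%:R * D) <= s j N by rewrite ler_norml; lra.
  rewrite /s (@le_trans _ _ (\sum_(x <- xs) (- D))) //.
    by rewrite big_const_seq count_predT iter_addr_0 -[leRHS]mulr_natl mulrN.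
  rewrite big_seq [leRHS]big_seq; apply: ler_sum => x /xs1 x1.
  rewrite supp_rotate //; have := supp_bound (x *m (A_ N)^T) (bY j N) (@YD j N).
  by rewrite orthogonal_enorm // x1 mulr1 ler_norml => /andP[].
pose I := inf [set sig j | j in [set j | (k <= j)%N]].
have I_lb j : (k <= j)%N -> I <= sig j.
  move=> kj; apply: ge_inf; last by exists j.
  by exists (- ((size xs)%:R * D) - 1) => _ [i _ <-].
have [J kJ sigJ] : exists2 J, (k <= J)%N & sig J <= I + c / 8.
  have [|_ [J /= kJ <-] h] := @inf_adherent R [set sig j | j in [set j | (k <= j)%N]] (c / 8) (divr_gt0 c0 (ltr0n _ 8)).
    split; first by exists (sig k), k => /=.
    by exists (- ((size xs)%:R * D) - 1) => _ [i _ <-].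
  by exists J => //; exact: ltW.
(* [sig j] is the limit of the sums over the net; it decreases in [j] and is
   within [c / 8] of its infimum from [J] on. *)
have close m u : (J <= m)%N -> enorm u = 1 -> supp (Y J m) u - supp (Km m) u < c.
  move=> Jm u1; rewrite ltNge; apply/negP => cle.
  have [N1 h1] := hs J (c / 16) (divr_gt0 c0 (ltr0n _ 16)).
  have [N2 h2] := hs m (c / 16) (divr_gt0 c0 (ltr0n _ 16)).
  pose l := maxn m (maxn N1 N2).
  have ml : (m <= l)%N by rewrite leq_maxl.
  have := h1 l; rewrite !leq_max leqnn orbT => /(_ isT).
  have := h2 l; rewrite !leq_max leqnn !orbT => /(_ isT).
  have gap0 := hgap _ _ (bKm m) (bY J m) (KmY _ _ kJ Jm) (@YD J m) u u1 cle.
  have := net_gap_minkowski [seq H_ i | i <- index_iota m.+1 l.+1] (bKm m) (bY J m) gap0 (AT l).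
  rewrite -!successiveE -Ycat // -/(Y m l) /net_gap sumrB.
  have sE j : \sum_(x <- xs) supp (Y j l) (x *m (A_ l)^T) = s j l.
    by rewrite /s; apply: eq_bigr => x _; rewrite supp_rotate.
  rewrite !sE !ler_norml; have := I_lb m (leq_trans kJ Jm); lra.
have [N hN] := sM J.+1 (Km J) (bKm J) c c0.
exists (maxn J N) => m p u; rewrite !geq_max => /andP[Jm Nm] /andP[Jp Np] u1.
have := hN m p u Nm Np u1.
have um q : enorm (u *m (A_ q)^T) = 1 by rewrite orthogonal_enorm.
have hq q : (J <= q)%N -> 
    supp (rotate (A_ q) (Km q)) u <= supp (rotate (A_ q) (Y J q)) u /\
    supp (rotate (A_ q) (Y J q)) u < supp (rotate (A_ q) (Km q)) u + c.
  move=> Jq; rewrite !supp_rotate // -ltrBlDl; split; last exact: close.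
  by apply: supp_sub => //; exact: KmY.
have [] := hq m Jm; have [] := hq p Jp.
rewrite -/(Km m) -/(Km p) -/(Y J m) -/(Y J p) !ler_norml.
have ce : e = 3 * c by rewrite /c mulrC divfK.
by clearbody c; lra.
Qed.

End MinkowskiToFamily.

(** * The support function of a fiber symmetral *)

Section FiberDuality.
Context (R : realType) (n : nat).
Implicit Types (u v w x y z : 'rV[R]_n) (K L X Y : set 'rV[R]_n) (H : {vspace 'rV[R]_n}).

(** The fiber symmetral is the section over [y - z \in orthoc H] of a product,
    so its support function is an infimal convolution. A unit vector of [orthoc H]
    serves as the additional coordinate of the separation argument. *)
Lemma supp_fiber_ge H X x c : proper_subspace H -> convex_body X ->
  (forall w, w \in H -> c <= (supp X (x + w) + supp X (reflection H (x - w))) / 2) ->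
  c <= supp (fiber_symm H X) x.
Proof.
move=> pH bX h; rewrite leNgt; apply/negP => Fc.
have bF := body_fiber H bX.
have [e eH e1] := exists_unit_orthoc pH.
pose val y z : R := dot x (2^-1 *: (y + reflection H z)).
(* The component of [f y z] in [H] records whether [y] and [z] lie in the same
   section, the component along [e] the value to be bounded. *)
pose f y z : 'rV[R]_n := (y - z) - proj_orthoc H (y - z) + val y z *: e.
have valF y z : X y -> X z -> y - z \in orthoc H -> val y z < c.
  move=> Xy Xz yz; apply: le_lt_trans Fc; apply: supp_ge => //.
  by apply/fiberP; exists y, z.
pose C := (fun p => f p.1 p.2) @` (X `*` X).
have bC : convex_body C.
  have [h1 h2 h3] := body_setX bX bX.
  apply: (@body_image2 _ _ _ f (1 + enorm x)) => //.
    move=> y z y' z'.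
    have -> : f y z - f y' z' = ((y - z) - (y' - z') - proj_orthoc H ((y - z) - (y' - z'))) +
       (val y z - val y' z') *: e.
      rewrite /f (proj_orthocB H (y - z)); apply/rowP => j; rewrite !mxE; ring.
    set d := y - z - (y' - z').
    have hd : enorm (d - proj_orthoc H d) <= enorm (y - y') + enorm (z - z').
      have hd1 : enorm (d - proj_orthoc H d) <= enorm d.
        rewrite -(ler_pXn2r (n:=2)) ?nnegrE ?enorm_ge0 // !enorm_sqr.
        by rewrite [leRHS](dot_orthoc_decomposition H d) lerDl dot_ge0.
      apply: le_trans hd1 _; have -> : d = (y - y') - (z - z').
        by apply/rowP => j; rewrite !mxE; ring.
      by rewrite (le_trans (enormD _ _)) // enormN.
    have hv : enorm ((val y z - val y' z') *: e) <= enorm x * (enorm (y - y') + enorm (z - z')).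
      rewrite enormZ e1 mulr1 /val -dotBr (le_trans (cauchy_schwarz_abs _ _)) //.
      rewrite ler_wpM2l ?enorm_ge0 // (le_trans (half_lipschitz _ _ _ _ _)) //.
      by rewrite mul1r.
    by rewrite (le_trans (enormD _ _)) // mulrDl mul1r lerD.
  move=> y z y' z' t; rewrite /f /val half_affine dotDr !dotZr.
  have -> : t *: y + (1 - t) *: y' - (t *: z + (1 - t) *: z') =
    t *: (y - z) + (1 - t) *: (y' - z') by apply/rowP => j; rewrite !mxE; ring.
  rewrite (proj_orthocD H (t *: _)) !proj_orthocZ.
  move: (proj_orthoc H _) (proj_orthoc H _) => p q.
  by apply/rowP => j; rewrite !mxE; ring.
have nC : ~ C (c *: e).
  move=> [[y z] [/= Xy Xz] fE].
  set q := (y - z) - proj_orthoc H (y - z) in fE.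
  have qH : q \in H := sub_proj_orthoc_mem H _.
  have qE : q = (c - val y z) *: e by rewrite scalerBl -fE /f addrK.
  have q0 : q = 0.
    apply: dot_eq0; rewrite {2}qE; apply: (dot_orthoc qH).
    exact: rpredZ.
  have yz : y - z \in orthoc H.
    by move/eqP: q0; rewrite /q subr_eq0 => /eqP ->; exact: proj_orthoc_mem.
  have := valF y z Xy Xz yz.
  suff -> : val y z = c by rewrite ltxx.
  have : enorm q = 0 by rewrite q0 enorm0.
  by rewrite qE enormZ e1 mulr1 => /normr0_eq0 /eqP; rewrite subr_eq0 => /eqP ->.
have [u u1 sep] : exists2 u, enorm u = 1 & supp C u < dot u (c *: e).
  apply: contrapT => hn; apply: nC; apply: in_body_supp => // u u1.
  by rewrite leNgt; apply/negP => lt; apply: hn; exists u.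
pose w0 := u - proj_orthoc H u; pose l := dot u e.
have w0H : w0 \in H := sub_proj_orthoc_mem H u.
have ineq y z : X y -> X z -> dot w0 (y - z) + l * val y z < c * l.
  move=> Xy Xz; have Cf : C (f y z) by exists (y, z).
  move: (le_lt_trans (supp_ge u bC Cf) sep); rewrite dotZr -/l.
  rewrite /f dotDr dotZr -/l dotBr -dot_proj_orthoc -dotBl -/w0.
  by rewrite (mulrC (val y z)).
(* Points with [y = z] are admissible and have value below [c], which fixes the
   sign of the multiplier [l]. *)
have l0 : 0 < l.
  have [[y Xy] _ _] := bX; have := ineq y y Xy Xy.
  have := valF y y Xy Xy; rewrite subrr mem0v => /(_ isT) vc.
  rewrite dot0r add0r mulrC -subr_gt0 -mulrBl pmulr_rgt0 //.
  by rewrite subr_gt0.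
pose w := (2 / l) *: w0.
have wH : w \in H by exact: rpredZ.
have := h w wH.
have [y Xy ->] := supp_attained (x + w) bX.
have [z Xz ->] := supp_attained (reflection H (x - w)) bX.
rewrite leNgt => /negP; apply.
rewrite reflectionB (reflection_sub wH) dotDl dotBl dot_reflection.
have := ineq y z Xy Xz; rewrite /val dotZr (dotDr y (reflection H z)).
have -> : dot w0 (y - z) = l / 2 * (dot w y - dot w z).
  rewrite -dotBr dotZl mulrA; have -> : l / 2 * (2 / l) = 1 by field; rewrite gt_eqF.
  by rewrite mul1r.
have -> : l / 2 * (dot w y - dot w z) + l * (2^-1 * (dot x y + dot x (reflection H z))) =
  (dot x y + dot w y + (dot x (reflection H z) - dot w z)) / 2 * l by field.
by rewrite ltr_pM2r.
Qed.

End FiberDuality.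

(** * Equivariant features on the sphere *)

Section Features.
Context (R : realType) (n : nat).
Implicit Types (u v w x y z : 'rV[R]_n) (H : {vspace 'rV[R]_n}) (f g : 'rV[R]_n -> R).

(** Uniform first-order expansions with quadratic remainder between points of the
    unit sphere: exactly what the estimate for one symmetrization consumes, and a
    property that passes to products without any differential calculus. *)
Definition sphere_C11 f : Prop := exists2 c : R, 0 <= c &
  forall x, enorm x = 1 -> exists v, [/\ enorm v <= c, `|f x| <= c &
    forall y, enorm y = 1 -> `|f y - f x - dot v (y - x)| <= c * enorm (y - x) ^+ 2].

Lemma unit_dist_le2 x y : enorm x = 1 -> enorm y = 1 -> enorm (y - x) <= 2.
Proof. by move=> x1 y1; have := enormD y (- x); rewrite enormN x1 y1; lra. Qed.

Lemma lipschitz_of_taylor (a : R) (v x y : 'rV[R]_n) (fx fy : R) : 0 <= a ->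
  enorm x = 1 -> enorm y = 1 -> enorm v <= a ->
  `|fy - fx - dot v (y - x)| <= a * enorm (y - x) ^+ 2 ->
  `|fy - fx| <= 3 * a * enorm (y - x).
Proof.
move=> a0 x1 y1 va; have := cauchy_schwarz_abs v (y - x).
have := unit_dist_le2 x1 y1; have := enorm_ge0 (y - x); have := enorm_ge0 v.
move: (enorm (y - x)) (dot v _) (enorm v) va => d t b ba b0 d0 d2.
have : b * d <= a * d by rewrite ler_wpM2r.
have : a * d ^+ 2 <= a * (2 * d) by rewrite ler_wpM2l // expr2 ler_wpM2r.
rewrite !ler_norml; lra.
Qed.

Lemma sphere_C11_const a : sphere_C11 (fun=> a).
Proof.
exists `|a| => // x _; exists 0; split=> // [|y _]; first by rewrite enorm0.
by rewrite dot0l !subrr normr0 mulr_ge0 // sqr_ge0.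
Qed.

Lemma sphere_C11_dot v : sphere_C11 (dot v).
Proof.
exists (enorm v) => [|x x1]; first exact: enorm_ge0.
exists v; split=> // [|y y1].
  by rewrite (le_trans (cauchy_schwarz_abs _ _)) // x1 mulr1.
by rewrite dotBr subrr normr0 mulr_ge0 ?enorm_ge0 // sqr_ge0.
Qed.

Lemma sphere_C11_mul f g : sphere_C11 f -> sphere_C11 g ->
  sphere_C11 (fun x => f x * g x).
Proof.
move=> [a a0 hf] [b b0 hg]; exists (5 * a * b); first by rewrite !mulr_ge0.
move=> x x1; have [vf [vfa fa ft]] := hf x x1; have [vg [vgb gb gt]] := hg x x1.
have ab0 : 0 <= a * b by rewrite mulr_ge0.
exists (g x *: vf + f x *: vg); split.
- rewrite (le_trans (enormD _ _)) // !enormZ.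
  have : `|g x| * enorm vf <= b * a by rewrite ler_pM ?enorm_ge0.
  have : `|f x| * enorm vg <= a * b by rewrite ler_pM ?enorm_ge0.
  by nra.
- by rewrite normrM; have : `|f x| * `|g x| <= a * b by [rewrite ler_pM]; nra.
- move=> y y1; have [_ [_ fya _]] := hf y y1.
  have tf := ft y y1; have tg := gt y y1.
  have lf := lipschitz_of_taylor a0 x1 y1 vfa tf.
  have cs := cauchy_schwarz_abs vg (y - x).
  rewrite dotDl !dotZl.
  have -> : f y * g y - f x * g x - (g x * dot vf (y - x) + f x * dot vg (y - x)) =
    f y * (g y - g x - dot vg (y - x)) + (f y - f x) * dot vg (y - x) +
    g x * (f y - f x - dot vf (y - x)) by ring.
  set d := enorm (y - x) in tf tg lf cs *; have d0 : 0 <= d := enorm_ge0 _.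
  apply: le_trans (ler_normD _ _) _.
  apply: le_trans (lerD (ler_normD _ _) (lexx _)) _; rewrite !normrM.
  have h1 : `|f y| * `|g y - g x - dot vg (y - x)| <= a * (b * d ^+ 2) by rewrite ler_pM.
  have h2 : `|f y - f x| * `|dot vg (y - x)| <= (3 * a * d) * (b * d).
    by rewrite ler_pM // (le_trans cs) // ler_wpM2r.
  have h3 : `|g x| * `|f y - f x - dot vf (y - x)| <= b * (a * d ^+ 2) by rewrite ler_pM.
  apply: le_trans (lerD (lerD h1 h2) h3) _.
  by rewrite le_eqVlt; apply/orP; left; apply/eqP; ring.
Qed.

(** The coordinates of an equivariant map span a finite-dimensional space of
    functions on the sphere on which the orthogonal group acts by isometries. *)
Record equivariant_features N (Phi : 'rV[R]_n -> 'rV[R]_N) (U : 'M[R]_n -> 'M[R]_N) : Prop :=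
  EquivariantFeatures {
    features_orthogonal : forall g : 'M[R]_n, g *m g^T = 1%:M -> U g *m (U g)^T = 1%:M;
    features_equivariant : forall (g : 'M[R]_n) x, g *m g^T = 1%:M -> Phi (x *m g) = Phi x *m U g;
    features_C11 : forall i, sphere_C11 (fun x => Phi x 0 i) }.

Definition feature_function f : Prop :=
  exists N (Phi : 'rV[R]_n -> 'rV[R]_N) (U : 'M[R]_n -> 'M[R]_N) (a : 'rV[R]_N),
    equivariant_features Phi U /\ forall x, f x = dot a (Phi x).

Lemma feature_function_const c : feature_function (fun=> c).
Proof.
exists 1%N, (fun=> const_mx 1), (fun=> 1%:M), (const_mx c); split.
  split=> [g _|g x _|i]; rewrite ?trmx1 ?mulmx1 //.
  have -> : (fun x : 'rV[R]_n => (const_mx 1 : 'rV[R]_1) 0 i) = fun=> 1.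
    by apply/funext => x; rewrite mxE.
  exact: sphere_C11_const.
by move=> x; rewrite dotE big_ord1 !mxE mulr1.
Qed.

Lemma feature_function_dot v : feature_function (dot v).
Proof.
exists n, id, id, v; split=> //; split=> // i.
have -> : (fun x : 'rV[R]_n => x 0 i) = dot (delta_mx 0 i).
  apply/funext => x; rewrite dotE (bigD1 i) //= big1 ?addr0 => [|j ji].
    by rewrite mxE !eqxx mul1r.
  by rewrite mxE (negbTE ji) andbF mul0r.
exact: sphere_C11_dot.
Qed.

Lemma feature_functionD f g : feature_function f -> feature_function g ->
  feature_function (fun x => f x + g x).
Proof.
move=> [N1 [P1 [U1 [a1 [[u1 e1 c1] h1]]]]] [N2 [P2 [U2 [a2 [[u2 e2 c2] h2]]]]].
exists (N1 + N2)%N, (fun x => row_mx (P1 x) (P2 x)),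
  (fun A => block_mx (U1 A) 0 0 (U2 A)), (row_mx a1 a2); split.
  split=> [g' gg|g' x gg|i].
  - rewrite tr_block_mx mulmx_block !trmx0 !mulmx0 !mul0mx !addr0 !add0r u1 // u2 //.
    by rewrite -scalar_mx_block.
  - by rewrite mul_row_block !mulmx0 addr0 add0r e1 // e2.
  - case: (split_ordP i) => j ->.
      have -> : (fun x => row_mx (P1 x) (P2 x) 0 (lshift N2 j)) = (fun x => P1 x 0 j).
        by apply/funext => x; rewrite row_mxEl.
      exact: c1.
    have -> : (fun x => row_mx (P1 x) (P2 x) 0 (rshift N1 j)) = (fun x => P2 x 0 j).
      by apply/funext => x; rewrite row_mxEr.
    exact: c2.
by move=> x; rewrite h1 h2 /dot tr_row_mx mul_row_col [RHS]mxE.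
Qed.

(** The features of a product are the tensor products of the features: the tensor
    product of orthogonal matrices is orthogonal. *)
Lemma feature_functionM f g : feature_function f -> feature_function g ->
  feature_function (fun x => f x * g x).
Proof.
move=> [N1 [P1 [U1 [a1 [[u1 e1 c1] h1]]]]] [N2 [P2 [U2 [a2 [[u2 e2 c2] h2]]]]].
exists (N1 * N2)%N, (fun x => mxtens.tensmx (P1 x) (P2 x) : 'rV_(N1 * N2)),
  (fun A => mxtens.tensmx (U1 A) (U2 A)), (mxtens.tensmx a1 a2 : 'rV_(N1 * N2)); split.
  split=> [g' gg|g' x gg|i].
  - rewrite mxtens.trmx_tens mxtens.tensmx_mul u1 // u2 //.
    apply/matrixP => i j; case: (mxtens.mxtens_indexP i) => i1 i2.
    case: (mxtens.mxtens_indexP j) => j1 j2.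
    rewrite mxtens.tensmxE !mxE (can_eq (@mxtens.mxtens_indexK _ _)) xpair_eqE.
    by case: (i1 == j1); rewrite ?mul1r ?mul0r.
  - by rewrite e1 // e2 //; exact: (esym (@mxtens.tensmx_mul _ 1 N1 1 N2 _ _ _ _ _ _)).
  - have -> : (fun x => (mxtens.tensmx (P1 x) (P2 x) : 'rV_(N1 * N2)) 0 i) =
      (fun x => P1 x 0 (mxtens.mxtens_unindex i).1 * P2 x 0 (mxtens.mxtens_unindex i).2).
      by apply/funext => x; rewrite mxE; congr (P1 x _ _ * P2 x _ _); exact: ord1.
    exact: sphere_C11_mul.
move=> x; rewrite h1 h2.
have E : mxtens.tensmx a1 a2 *m (mxtens.tensmx (P1 x) (P2 x))^T =
    mxtens.tensmx (a1 *m (P1 x)^T) (a2 *m (P2 x)^T).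
  by rewrite mxtens.trmx_tens mxtens.tensmx_mul.
have := congr1 (fun A : 'M[R]_1 => A 0 0) E; rewrite [X in _ = X -> _]mxE => AE.
rewrite [RHS]AE.
by rewrite /dot; congr (_ * _); congr (fun_of_matrix _ _ _); exact/esym/ord1.
Qed.

(** Uniform control of the functions spanned by the features by the norm of
    their coefficient vector. *)
Lemma features_bound N (Phi : 'rV[R]_n -> 'rV[R]_N) (U : 'M[R]_n -> 'M[R]_N) :
  equivariant_features Phi U -> exists2 c : R, 0 <= c & forall a x, enorm x = 1 ->
    exists v, [/\ enorm v <= c * enorm a, `|dot a (Phi x)| <= c * enorm a &
      forall y, enorm y = 1 -> `|dot a (Phi y) - dot a (Phi x) - dot v (y - x)| <=
        c * enorm a * enorm (y - x) ^+ 2].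
Proof.
move=> [_ _ c11].
have hex i : exists d : R, 0 <= d /\ forall x, enorm x = 1 ->
    exists v, [/\ enorm v <= d, `|Phi x 0 i| <= d &
    forall y, enorm y = 1 -> `|Phi y 0 i - Phi x 0 i - dot v (y - x)| <= d * enorm (y - x) ^+ 2].
  by have [d d0 hd] := c11 i; exists d.
have [c hc] := choice hex.
have c0 i : 0 <= c i by case: (hc i).
exists (\sum_i c i); first exact: sumr_ge0.
move=> a x x1.
have hexv i : exists v, [/\ enorm v <= c i, `|Phi x 0 i| <= c i &
    forall y, enorm y = 1 -> `|Phi y 0 i - Phi x 0 i - dot v (y - x)| <= c i * enorm (y - x) ^+ 2].
  by have [_ /(_ x x1)] := hc i.
have [v hv] := choice hexv.
have bnd (F G : 'I_N -> R) (d : R) : (forall i, `|F i| <= `|a 0 i| * G i) ->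
   (forall i, 0 <= G i) -> (forall i, G i <= c i * d) -> 0 <= d ->
   `|\sum_i F i| <= (\sum_i c i) * enorm a * d.
  move=> FG G0 Gc d0; apply: le_trans (ler_norm_sum _ _ _) _.
  rewrite !mulr_suml; apply: ler_sum => i _; apply: le_trans (FG i) _.
  rewrite -mulrA mulrCA; apply: ler_pM => //; exact: coord_le_enorm.
have sumB (P Q : 'I_N -> R) : \sum_i P i - \sum_i Q i = \sum_i (P i - Q i).
  by rewrite sumrB.
exists (\sum_i a 0 i *: v i); split.
- have tri (s : seq 'I_N) : enorm (\sum_(i <- s) a 0 i *: v i) <= \sum_(i <- s) c i * enorm a.
    elim: s => [|i s IH]; first by rewrite !big_nil enorm0.
    rewrite !big_cons (le_trans (enormD _ _)) // lerD // enormZ mulrC.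
    by have [vc _ _] := hv i; rewrite ler_pM ?enorm_ge0 ?coord_le_enorm.
  by rewrite mulr_suml; exact: tri.
- rewrite dotE -[leRHS]mulr1; apply: (bnd _ (fun i => c i)) => // [i|i]; last by rewrite mulr1.
  by have [_ h _] := hv i; rewrite normrM ler_wpM2l.
- move=> y y1; have dv : dot (\sum_i a 0 i *: v i) (y - x) = \sum_i a 0 i * dot (v i) (y - x).
    elim/big_rec2: _ => [|i p q _ <-]; first by rewrite dot0l.
    by rewrite dotDl dotZl.
  rewrite dv !dotE !sumB.
  apply: (bnd _ (fun i => c i * enorm (y - x) ^+ 2)) => // [i|i|]; last by rewrite sqr_ge0.
    have [_ _ /(_ y y1) h] := hv i; rewrite -!mulrBr normrM ler_wpM2l //.
  by rewrite mulr_ge0 // sqr_ge0.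
Qed.

End Features.

(** * One fiber symmetrization of a body with a large ball summand *)

Section FiberStep.
Context (R : realType) (n : nat).
Implicit Types (u v w x y z : 'rV[R]_n) (H : {vspace 'rV[R]_n}) (X : set 'rV[R]_n).

(** The excess of [r1 + r2] over [2] is the gain from the strict convexity of the
    norm. It controls how far the two directions turn away from [x], and also how
    unequal the two norms are, but the latter only up to the distance from [x] to
    [H]: moving a vector of [H] along itself makes the norms unequal at no cost. *)
Lemma split_direction H x w (r1 r2 : R) t1 t2 :
  enorm x = 1 -> enorm t1 = 1 -> enorm t2 = 1 -> 0 <= r1 -> 0 <= r2 -> w \in H ->
  x + w = r1 *: t1 -> x - w = r2 *: t2 ->
  [/\ 2 <= r1 + r2,
      r1 * enorm (t1 - x) ^+ 2 + r2 * enorm (t2 - x) ^+ 2 = 2 * (r1 + r2 - 2) &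
      ((r1 - r2) * enorm (proj_orthoc H x)) ^+ 2 <= (r1 + r2) ^+ 2 - 4].
Proof.
move=> x1 t11 t21 r10 r20 wH e1 e2.
have xx : dot x x = 1 by rewrite -enorm_sqr x1 expr1n.
have tt1 : dot t1 t1 = 1 by rewrite -enorm_sqr t11 expr1n.
have tt2 : dot t2 t2 = 1 by rewrite -enorm_sqr t21 expr1n.
have n1 : r1 ^+ 2 = 1 + 2 * dot x w + dot w w.
  have : dot (x + w) (x + w) = dot (r1 *: t1) (r1 *: t1) by rewrite e1.
  by rewrite !dot_lin tt1 xx (dotC w x); lra.
have n2 : r2 ^+ 2 = 1 - 2 * dot x w + dot w w.
  have : dot (x - w) (x - w) = dot (r2 *: t2) (r2 *: t2) by rewrite e2.
  by rewrite !dot_lin tt2 xx (dotC w x); lra.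
have d1 : r1 * dot x t1 = 1 + dot x w by rewrite -dotZr -e1 dotDr xx.
have d2 : r2 * dot x t2 = 1 - dot x w by rewrite -dotZr -e2 dotBr xx.
have ge2 : 2 <= r1 + r2.
  have h1 := cauchy_schwarz x t1; have h2 := cauchy_schwarz x t2.
  rewrite x1 t11 mul1r in h1; rewrite x1 t21 mul1r in h2.
  by have := ler_wpM2l r10 h1; have := ler_wpM2l r20 h2; lra.
split=> //.
  have sq t : dot t t = 1 -> enorm (t - x) ^+ 2 = 2 - 2 * dot x t.
    by move=> tt; rewrite enorm_sqr dotBl !dotBr tt xx (dotC t x); ring.
  rewrite !sq //.
  have -> : r1 * (2 - 2 * dot x t1) + r2 * (2 - 2 * dot x t2) =
    2 * (r1 + r2) - 2 * (r1 * dot x t1 + r2 * dot x t2) by ring.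
  by rewrite d1 d2; ring.
have xw : dot x w = dot (x - proj_orthoc H x) w.
  by rewrite dotBl dot_proj_orthoc (proj_orthoc_sub wH) dot0r subr0.
have pyth := dot_orthoc_decomposition H x; rewrite xx -!enorm_sqr in pyth.
have cs := cauchy_schwarz_abs (x - proj_orthoc H x) w; rewrite -xw in cs.
have cs2 : dot x w ^+ 2 <= enorm (x - proj_orthoc H x) ^+ 2 * dot w w.
  rewrite -enorm_sqr -exprMn -(real_normK (num_real (dot x w))).
  by rewrite ler_pXn2r ?nnegrE ?mulr_ge0 ?enorm_ge0.
rewrite exprMn.
have W0 := dot_ge0 w.
move: (dot x w) (dot w w) (enorm (x - _) ^+ 2) (enorm (proj_orthoc H x) ^+ 2)
  (sqr_ge0 (enorm (proj_orthoc H x))) pyth n1 n2 cs2 W0 => g W q p p0 pyth n1 n2 cs2 W0.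
set S := r1 + r2; set t := r1 - r2.
have St : S * t = 4 * g by rewrite /S /t; nra.
have S2t2 : S ^+ 2 + t ^+ 2 = 4 + 4 * W by rewrite /S /t; nra.
have S4 : 0 <= S ^+ 2 - 4 by have : 2 * 2 <= S * S by [exact: ler_pM]; rewrite -expr2; lra.
have h1 : S ^+ 2 * t ^+ 2 = 16 * g ^+ 2 by rewrite -exprMn St exprMn; ring.
have h2 : S ^+ 2 * t ^+ 2 <= 4 * q * (S ^+ 2 + t ^+ 2 - 4).
  by rewrite h1 S2t2; nra.
have qE : q = 1 - p by lra.
have t20 : 0 <= t ^+ 2 := sqr_ge0 t.
move: (S ^+ 2) (t ^+ 2) S4 h2 t20 => a b a4 h2 b0.
rewrite qE in h2.
have h3 : 0 <= b * (a - 4) by rewrite mulr_ge0.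
have h4 : 0 <= p * (a - 4) by rewrite mulr_ge0.
nra.
Qed.

(** The first-order gain of the odd part is absorbed by the convexity of the
    norm up to a loss quadratic in the Lipschitz constant [g] of the odd part. *)
Lemma odd_part_absorbed (rho g d r1 r2 d1 d2 B : R) : 0 < rho -> 0 <= g ->
  32 * g <= rho -> 0 <= d -> 0 <= r1 -> 0 <= r2 -> r1 + r2 = 2 + d ->
  r1 * d1 ^+ 2 + r2 * d2 ^+ 2 = 2 * d -> B ^+ 2 <= (r1 + r2) ^+ 2 - 4 ->
  g * (r1 * d1 + r2 * d2 + B) <= 3 / 8 * rho * d + 16 * g ^+ 2 / rho.
Proof.
move=> rho0 g0 grho d0 r10 r20 rE dE BE.
set A := r1 * d1 + r2 * d2.
have A2 : A ^+ 2 <= (2 + d) * (2 * d).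
  rewrite -dE -rE /A; have := sqr_ge0 (d1 - d2).
  have : 0 <= r1 * r2 by rewrite mulr_ge0.
  by nra.
pose s := Num.sqrt d; have s0 : 0 <= s := sqrtr_ge0 _.
have sE : s ^+ 2 = d by rewrite sqr_sqrtr.
(* The square of the right-hand side dominates [2 * A ^+ 2 + 2 * B ^+ 2], which is
   at most [16 * d + 6 * d ^+ 2]. *)
have AB : A + B <= 4 * s + 3 * s ^+ 2.
  apply: le_trans (ler_norm _) _.
  rewrite -(ler_pXn2r (n:=2)) ?nnegrE ?normr_ge0 ?addr_ge0 ?mulr_ge0 ?sqr_ge0 //.
  rewrite real_normK ?num_real //.
  have : (A + B) ^+ 2 <= 2 * A ^+ 2 + 2 * B ^+ 2 by have := sqr_ge0 (A - B); nra.
  rewrite rE in BE.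
  have -> : (4 * s + 3 * s ^+ 2) ^+ 2 = 16 * d + 24 * (s * d) + 9 * d ^+ 2.
    by rewrite -sE; ring.
  have : 0 <= s * d by rewrite mulr_ge0.
  have : 0 <= d ^+ 2 := sqr_ge0 _.
  by nra.
apply: le_trans (ler_wpM2l g0 AB) _.
rewrite -(ler_pM2l rho0) [leRHS]mulrDr [rho * (16 * _ / _)]mulrC divfK ?gt_eqF //.
have := sqr_ge0 (rho * s / 2 - 4 * g).
have : 0 <= (rho - 32 * g) * (rho * s ^+ 2) by rewrite !mulr_ge0 ?subr_ge0 ?sqr_ge0 // ltW.
have : 0 <= rho ^+ 2 * s ^+ 2 by rewrite mulr_ge0 ?sqr_ge0.
rewrite -sE; nra.
Qed.

(** One fiber symmetrization, seen from below. The coefficient vector [a] splits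
    into its even and odd parts under the reflection; the even part is what
    Minkowski symmetrization keeps, and the loss is of second order in the odd
    part, with a factor that the radius [rho] makes small. *)
Lemma fiber_step N (Phi : 'rV[R]_n -> 'rV[R]_N) (U : 'M[R]_n -> 'M[R]_N) c H X a rho :
  equivariant_features Phi U -> 0 <= c ->
  (forall (a : 'rV_N) x, enorm x = 1 ->
    exists v, [/\ enorm v <= c * enorm a, `|dot a (Phi x)| <= c * enorm a &
      forall y, enorm y = 1 -> `|dot a (Phi y) - dot a (Phi x) - dot v (y - x)| <=
        c * enorm a * enorm (y - x) ^+ 2]) ->
  proper_subspace H -> convex_body X -> 0 < rho -> 96 * c * enorm a <= rho ->
  (forall u, enorm u = 1 -> rho + dot a (Phi u) <= supp X u) ->
  exists a', [/\ enorm a' <= enorm a,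
    forall x, dot a' (Phi x) = (dot a (Phi x) + dot a (Phi (reflection H x))) / 2 &
    forall u, enorm u = 1 ->
      rho - 72 * c ^+ 2 / rho * (enorm a ^+ 2 - enorm a' ^+ 2) + dot a' (Phi u)
      <= supp (fiber_symm H X) u].
Proof.
move=> feat c0 hc pH bX rho0 crho hX.
pose b := a *m (U (reflection_mx H))^T.
have UU := features_orthogonal feat (reflection_mx_orthogonal H).
have bE x : dot b (Phi x) = dot a (Phi (reflection H x)).
  rewrite -mul_reflection_mx (features_equivariant feat) ?reflection_mx_orthogonal //.
  by rewrite /b dot_mulmx trmxK.
have bb : dot b b = dot a a by rewrite /b orthogonal_dot // orthogonal_trmx.
pose s := 2^-1 *: (a + b); pose o := 2^-1 *: (a - b).
have so : dot s s + dot o o = dot a a.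
  by rewrite /s /o !dot_lin bb (dotC b a); lra.
have sE x : dot s (Phi x) = (dot a (Phi x) + dot a (Phi (reflection H x))) / 2.
  by rewrite /s dotZl dotDl bE mulrC.
have oE x : dot o (Phi x) = (dot a (Phi x) - dot a (Phi (reflection H x))) / 2.
  by rewrite /o dotZl dotBl bE mulrC.
have na := enorm_ge0 a; have no := enorm_ge0 o.
have sa : enorm s <= enorm a.
  by rewrite -(ler_pXn2r (n:=2)) ?nnegrE ?enorm_ge0 // !enorm_sqr -so lerDl dot_ge0.
have oa : enorm o <= enorm a.
  by rewrite -(ler_pXn2r (n:=2)) ?nnegrE ?enorm_ge0 // !enorm_sqr -so lerDr dot_ge0.
exists s; split=> // x x1.
have -> : enorm a ^+ 2 - enorm s ^+ 2 = enorm o ^+ 2 by rewrite !enorm_sqr -so; ring.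
apply: supp_fiber_ge => // w wH.
have [t1 t11 e1] := polar_decomposition (x + w) x1.
have [t2 t21 e2] := polar_decomposition (x - w) x1.
set r1 := enorm (x + w) in e1; set r2 := enorm (x - w) in e2.
have r10 : 0 <= r1 := enorm_ge0 _; have r20 : 0 <= r2 := enorm_ge0 _.
have [S2 dE dP] := split_direction x1 t11 t21 r10 r20 wH e1 e2.
have sum2 : r1 *: t1 + r2 *: t2 = 2 *: x.
  by rewrite -e1 -e2 addrACA subrr addr0 scaler_nat mulr2n.
have X1 : r1 * (rho + dot s (Phi t1) + dot o (Phi t1)) <= supp X (x + w).
  rewrite e1 suppZ // ler_wpM2l // (le_trans _ (hX t1 t11)) //.
  by rewrite sE oE; lra.
have X2 : r2 * (rho + dot s (Phi t2) - dot o (Phi t2)) <= supp X (reflection H (x - w)).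
  rewrite e2 reflectionZ suppZ // ler_wpM2l // (le_trans _ (hX _ _)) //; last first.
    by rewrite enorm_reflection.
  by rewrite sE oE; lra.
have [v [vc sx st]] := hc s x x1; have [vo [voc ox ot]] := hc o x x1.
set d := r1 + r2 - 2 in dE *.
have d0 : 0 <= d by rewrite subr_ge0.
have even : 2 * dot s (Phi x) - 4 * (c * enorm a) * d <=
    r1 * dot s (Phi t1) + r2 * dot s (Phi t2).
  have := st t1 t11; have := st t2 t21; rewrite !ler_norml => /andP[g2 _] /andP[g1 _].
  have := ler_wpM2l r10 g1; have := ler_wpM2l r20 g2.
  have vsum : r1 * dot v (t1 - x) + r2 * dot v (t2 - x) = - d * dot v x.
    have : dot v (r1 *: t1 + r2 *: t2) = 2 * dot v x by rewrite sum2 dotZr.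
    by rewrite (dotDr (r1 *: t1)) !dotZr !dotBr /d; nra.
  have vx := cauchy_schwarz v x; rewrite x1 mulr1 in vx.
  have csca : c * enorm s <= c * enorm a by rewrite ler_wpM2l.
  have : d * dot v x <= d * (c * enorm a).
    by rewrite ler_wpM2l // (le_trans vx) // (le_trans vc).
  have : d * - dot s (Phi x) <= d * (c * enorm a).
    by rewrite ler_wpM2l //; move: sx; rewrite ler_norml; lra.
  have : c * enorm s * (2 * d) <= c * enorm a * (2 * d) by rewrite ler_wpM2r // mulr_ge0.
  rewrite -{1}dE.
  have dd : d = r1 + r2 - 2 by [].
  move: (enorm (t1 - x) ^+ 2) (enorm (t2 - x) ^+ 2) vsum => q1 q2 vsum.
  by move: dd; clearbody d => dd; nra.
pose g := 3 * (c * enorm o).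
have g0 : 0 <= g by rewrite !mulr_ge0.
have lipo y : enorm y = 1 -> `|dot o (Phi y) - dot o (Phi x)| <= g * enorm (y - x).
  by move=> y1; apply: (@lipschitz_of_taylor _ _ _ vo) => //; [rewrite mulr_ge0|exact: ot].
(* The odd part vanishes on [H], hence is small near [H]: this compensates the
   imbalance of [r1] and [r2]. *)
have ox0 : `|dot o (Phi x)| <= g * enorm (proj_orthoc H x).
  have := lipo (reflection H x); rewrite enorm_reflection => /(_ x1).
  have -> : dot o (Phi (reflection H x)) - dot o (Phi x) = - (2 * dot o (Phi x)).
    by rewrite !oE reflectionK; lra.
  rewrite enormB sub_reflection enormZ normrN normrM (ger0_norm (ler0n R 2)).
  by rewrite mulrCA ler_pM2l.
have odd : - (g * (r1 * enorm (t1 - x) + r2 * enorm (t2 - x) +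
      `|r1 - r2| * enorm (proj_orthoc H x))) <=
    r1 * dot o (Phi t1) - r2 * dot o (Phi t2).
  have := lipo t1 t11; have := lipo t2 t21; rewrite !ler_norml => /andP[_ g2] /andP[g1 _].
  have := ler_wpM2l r10 g1; have := ler_wpM2l r20 g2.
  have : `|(r1 - r2) * dot o (Phi x)| <= `|r1 - r2| * (g * enorm (proj_orthoc H x)).
    by rewrite normrM; exact: (ler_wpM2l (normr_ge0 _) ox0).
  by rewrite ler_norml; nra.
have coa : c * enorm o <= c * enorm a by rewrite ler_wpM2l.
have := @odd_part_absorbed rho g d r1 r2 (enorm (t1 - x)) (enorm (t2 - x))
  (`|r1 - r2| * enorm (proj_orthoc H x)) rho0 g0.
have -> : (`|r1 - r2| * enorm (proj_orthoc H x)) ^+ 2 = ((r1 - r2) * enorm (proj_orthoc H x)) ^+ 2.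
  by rewrite !exprMn real_normK // num_real.
have g32 : 32 * g <= rho by rewrite /g; lra.
have rd : r1 + r2 = 2 + d by rewrite /d; ring.
move=> /(_ g32 d0 r10 r20 rd dE dP) main.
have gE : 16 * g ^+ 2 / rho = 2 * (72 * c ^+ 2 / rho * enorm o ^+ 2).
  by rewrite /g; field; rewrite gt_eqF.
rewrite gE in main.
have ca : 96 * (c * enorm a) * d <= rho * d by rewrite ler_wpM2r // mulrA.
rewrite ler_pdivlMr //; nra.
Qed.

End FiberStep.

(** * Approximation of support functions *)

Section Density.
Context (R : realType) (n : nat).
Implicit Types (u v w x y z : 'rV[R]_n) (K : set 'rV[R]_n) (f g : 'rV[R]_n -> R).

(** The functions uniformly approximable on the sphere by functions spanned by
    equivariant features; closed under maxima, as in the lattice form of the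
    Stone-Weierstrass theorem. *)
Definition feature_limit f : Prop := forall e, 0 < e ->
  exists2 p, feature_function p & forall u, enorm u = 1 -> `|p u - f u| <= e.

Lemma feature_limit_function f : feature_function f -> feature_limit f.
Proof. by move=> ff e e0; exists f => // u _; rewrite subrr normr0 ltW. Qed.

Lemma feature_limitD f g : feature_limit f -> feature_limit g ->
  feature_limit (fun x => f x + g x).
Proof.
move=> hf hg e e0; have e2 : 0 < e / 2 by rewrite divr_gt0.
have [p fp pf] := hf _ e2; have [q fq qg] := hg _ e2.
exists (fun x => p x + q x); first exact: feature_functionD.
by move=> u u1; have := pf u u1; have := qg u u1; rewrite !ler_norml; lra.
Qed.

Lemma feature_functionZ c f : feature_function f -> feature_function (fun x => c * f x).
Proof. by move=> hf; apply: feature_functionM hf; exact: feature_function_const. Qed.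

Lemma feature_limitZ c f : feature_limit f -> feature_limit (fun x => c * f x).
Proof.
move=> hf e e0; have c0 : 0 < `|c| + 1 by rewrite ltr_wpDl.
have [p fp pf] := hf _ (divr_gt0 e0 c0).
exists (fun x => c * p x); first exact: feature_functionZ.
move=> u u1; rewrite -mulrBr normrM.
apply: le_trans (ler_wpM2l (normr_ge0 _) (pf u u1)) _.
by rewrite mulrCA ler_piMr ?(ltW e0) // ler_pdivrMr // mul1r lerDl.
Qed.

Lemma feature_function_bounded f : feature_function f ->
  exists2 b : R, 0 < b & forall u, enorm u = 1 -> `|f u| <= b.
Proof.
move=> [N [P [U [a [feat fE]]]]]; have [c c0 hc] := features_bound feat.
exists (c * enorm a + 1); first by rewrite ltr_wpDl // mulr_ge0 ?enorm_ge0.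
move=> u u1; have [v [_ h _]] := hc a u u1; rewrite fE.
by rewrite (le_trans h) // lerDl.
Qed.

(** The classical polynomial iteration for the absolute value. *)
Fixpoint abs_iter (i : nat) (t : R) : R :=
  if i is i.+1 then abs_iter i t + (t ^+ 2 - abs_iter i t ^+ 2) / 2 else 0.

Lemma abs_iter_bounds i t : `|t| <= 1 ->
  0 <= abs_iter i t <= `|t| /\ `|t| - abs_iter i t <= 2 / i.+2%:R.
Proof.
move=> t1; elim: i => [|i [/andP[q0 qt] IH]] /=.
  split; first by rewrite lexx normr_ge0.
  by rewrite subr0 divff ?pnatr_eq0.
rewrite -(real_normK (num_real t)); have := normr_ge0 t.
move: (`|t|) (abs_iter i t) t1 q0 qt IH => s q s1 q0 qs IH s0.
have p0 : 0 < i.+2%:R :> R by rewrite ltr0n.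
have p3 : 0 < i.+3%:R :> R by rewrite ltr0n.
have pE : i.+3%:R = i.+2%:R + 1 :> R by rewrite -natr1.
have p2 : 2 <= i.+2%:R :> R by rewrite ler_nat.
split; first by apply/andP; split; nra.
rewrite ler_pdivlMr // in IH; rewrite ler_pdivlMr // pE.
move: (i.+2%:R) p0 p2 IH => p p0 p2 IH.
have h1 : s - (q + (s ^+ 2 - q ^+ 2) / 2) <= (s - q) * (1 - (s - q) / 2).
  have : 0 <= (s - q) * q by rewrite mulr_ge0 ?subr_ge0.
  by nra.
have d0 : 0 <= s - q by rewrite subr_ge0.
have d1 : s - q <= 1 by lra.
(* With [d * p <= 2], either [d * (p + 1) <= 2] already, or the factor
   [1 - d / 2] makes up for the excess. *)
move: (s - q) d0 d1 IH h1 => d d0 d1 IH h1.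
have h2 : d * (1 - d / 2) * (p + 1) <= 2.
  have [h|h] := lerP (d * (p + 1)) 2.
    have : 0 <= d * (d * (p + 1)) by rewrite !mulr_ge0 // addr_ge0 // ltW.
    by nra.
  have : 0 <= (2 - d * p) * (1 - d / 2) by apply: mulr_ge0; lra.
  by nra.
apply: le_trans h2; rewrite ler_wpM2r //; lra.
Qed.

Lemma feature_limit_abs f : feature_limit f -> feature_limit (fun x => `|f x|).
Proof.
move=> hf e e0; have e2 : 0 < e / 2 by rewrite divr_gt0.
have [p fp pf] := hf _ e2; have [b b0 pb] := feature_function_bounded fp.
have [i hi] : exists i : nat, 2 * b <= e / 2 * i.+2%:R.
  have := archi_boundP (x := 2 * b / (e / 2)); rewrite divr_ge0 ?mulr_ge0 ?ltW //.
  move=> /(_ isT) h; exists (Num.bound (2 * b / (e / 2))).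
  rewrite -ler_pdivrMl // mulrC (le_trans (ltW h)) // ler_nat; lia.
have fq : feature_function (fun x => abs_iter i (b^-1 * p x)).
  elim: i {hi} => [|i IH] /=; first exact: feature_function_const.
  have fs h : feature_function h -> feature_function (fun x => h x ^+ 2).
    by move=> fh; have := feature_functionM fh fh.
  have fp' := feature_functionZ b^-1 fp.
  have := feature_functionD IH (feature_functionZ 2^-1 (feature_functionD (fs _ fp')
    (feature_functionZ (-1) (fs _ IH)))).
  congr feature_function; apply/funext => x; congr (_ + _).
  by rewrite mulN1r mulrC.
exists (fun x => b * abs_iter i (b^-1 * p x)); first exact: feature_functionZ.
move=> u u1.
have t1 : `|b^-1 * p u| <= 1.
  rewrite normrM gtr0_norm ?invr_gt0 // -ler_pdivlMl ?invr_gt0 // invrK mulr1.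
  exact: pb.
have [/andP[q0 q1] q2] := abs_iter_bounds i t1.
have pE : `|p u| = b * `|b^-1 * p u|.
  by rewrite normrM gtr0_norm ?invr_gt0 // mulrA divff ?mul1r // gt_eqF.
have h1 : `|p u| - b * abs_iter i (b^-1 * p u) <= e / 2.
  rewrite pE -mulrBr; apply: le_trans (ler_wpM2l (ltW b0) q2) _.
  by rewrite mulrA ler_pdivrMr // mulrC.
have h2 : b * abs_iter i (b^-1 * p u) <= `|p u| by rewrite pE ler_wpM2l // ltW.
have := le_trans (ler_dist_dist (p u) (f u)) (pf u u1).
rewrite !ler_norml; lra.
Qed.

Lemma feature_limit_max f g : feature_limit f -> feature_limit g ->
  feature_limit (fun x => Num.max (f x) (g x)).
Proof.
move=> hf hg.
have hd : feature_limit (fun x => f x + -1 * g x) by apply/feature_limitD/feature_limitZ.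
have := feature_limitZ 2^-1 (feature_limitD (feature_limitD hf hg) (feature_limit_abs hd)).
congr feature_limit; apply/funext => x; rewrite mulN1r.
by case: (lerP (f x) (g x)) => h; lra.
Qed.

(** A body is nearly the convex hull of a finite net, whose support function is
    a maximum of linear functions. *)
Lemma feature_limit_supp K : convex_body K -> feature_limit (supp K).
Proof.
move=> bK e e0; have e2 : 0 < e / 2 by rewrite divr_gt0.
have [[y0 Ky0] cK _] := bK.
have [ys Kys net] := compact_net cK e2.
pose m := fun x => foldr (fun y r => Num.max (dot y x) r) (dot y0 x) ys.
have fm : feature_limit m.
  rewrite /m; elim: (ys) => [|y s IH] /=.
    exact/feature_limit_function/feature_function_dot.
  by apply: feature_limit_max => //; exact/feature_limit_function/feature_function_dot.
have [p fp pm] := fm _ e2; exists p => // u u1.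
have ub : m u <= supp K u.
  rewrite /m; elim: (ys) Kys => [|y s IH] Kys /=; first by rewrite dotC supp_ge.
  have Ky : K y by apply: Kys; rewrite mem_head.
  rewrite ge_max (dotC y) supp_ge //=; apply: IH => x xs.
  by apply: Kys; rewrite inE xs orbT.
have lb : supp K u <= m u + e / 2.
  apply: supp_le => // y Ky; have [z zs yz] := net y Ky.
  have zm : dot z u <= m u.
    rewrite /m; elim: (ys) zs => [//|x s IH] /=; rewrite inE le_max.
    by move=> /orP[/eqP ->|/IH ->]; rewrite ?lexx ?orbT.
  have := cauchy_schwarz u (y - z); rewrite u1 mul1r dotBr (dotC u z); lra.
by have := pm u u1; rewrite !ler_norml; lra.
Qed.

End Density.

(** * From the family to Minkowski symmetrization *)

Section Comparison.
Context (R : realType) (n : nat).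
Implicit Types (u v w x y z : 'rV[R]_n) (K : set 'rV[R]_n) (H : {vspace 'rV[R]_n}).
Implicit Types (S T : set_operation R n) (Hs : seq {vspace 'rV[R]_n}).

Local Notation M := (@minkowski_symm R n).

Lemma supp_process_minkowski_ball Hs K r u : convex_body K -> 0 <= r -> enorm u = 1 ->
  supp (process M Hs (msum K (eball r))) u = supp (process M Hs K) u + r.
Proof.
move=> bK r0; have bB := body_eball n r0; have bKB := body_msum bK bB.
elim/last_ind: Hs u => [|Hs H IH] u u1; first by rewrite supp_msum ?supp_eball.
rewrite !supp_process_minkowski_rcons // !IH ?enorm_reflection //; lra.
Qed.

(** On bodies containing a large ball as a summand, every symmetrization of the
    family follows the Minkowski process, uniformly in the number of steps: the
    losses of the single steps sum to a telescoping series. *)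
Lemma process_large_ball K e : convex_body K -> 0 < e -> exists2 r, 0 <= r &
  forall S Hs, familyF S -> all_proper Hs -> forall u, enorm u = 1 ->
    `|supp (process S Hs (msum K (eball r))) u - r - supp (process M Hs K) u| <= e.
Proof.
move=> bK e0; have e3 : 0 < e / 3 by rewrite divr_gt0.
have [p [N [Phi [U [a0 [feat pE]]]]] papp] := feature_limit_supp bK e3.
have [c c0 hc] := features_bound feat.
have n0 := enorm_ge0 a0.
pose rho := 96 * c * enorm a0 + 72 * c ^+ 2 * enorm a0 ^+ 2 / (e / 3) + 1.
have rho0 : 0 < rho.
  by rewrite ltr_wpDl // addr_ge0 // ?divr_ge0 ?mulr_ge0 ?sqr_ge0 // ltW.
have rho1 : 96 * c * enorm a0 <= rho.
  by rewrite /rho -addrA lerDl addr_ge0 // divr_ge0 ?mulr_ge0 ?sqr_ge0 // ltW.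
pose k := 72 * c ^+ 2 / rho.
have k0 : 0 <= k by rewrite divr_ge0 ?mulr_ge0 ?sqr_ge0 // ltW.
have ka : k * enorm a0 ^+ 2 <= e / 3.
  rewrite /k mulrAC ler_pdivrMr // [leRHS]mulrC -ler_pdivrMr // /rho.
  by rewrite -addrA addrCA lerDl addr_ge0 // !mulr_ge0.
pose r := rho + k * enorm a0 ^+ 2 + e / 3.
have r0 : 0 <= r.
  apply: addr_ge0; last exact: ltW.
  by apply: addr_ge0; [exact: ltW|rewrite mulr_ge0 ?sqr_ge0].
exists r => // S Hs fS.
have bB := body_eball n r0; have bKB := body_msum bK bB.
(* The radius decreases from [rho + k * enorm a0 ^+ 2] to no less than [rho]: at
   each step it pays for the loss with the decrease of [enorm a ^+ 2]. *)
move=> pHs; have [a [aa lowS appM]] : exists a, [/\ enorm a <= enorm a0,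
    forall u, enorm u = 1 ->
      rho + k * enorm a ^+ 2 + dot a (Phi u) <= supp (process S Hs (msum K (eball r))) u &
    forall u, enorm u = 1 -> `|dot a (Phi u) - supp (process M Hs K) u| <= e / 3].
  elim/last_ind: Hs pHs => [_|Hs H IH /all_proper_rcons[/[dup] pHs /IH[a [aa lowS appM]] pH]].
    exists a0; split=> // u u1; last by rewrite -pE papp.
    rewrite /process /= supp_msum // supp_eball // /r.
    by have := papp u u1; rewrite pE ler_norml; lra.
  have bP := body_process fS pHs bKB.
  have rk0 : 0 < rho + k * enorm a ^+ 2 by rewrite ltr_pwDl // mulr_ge0 ?sqr_ge0 //.
  have [||a' [a'a a'E step]] := fiber_step feat c0 hc pH bP rk0 (a := a) => //.
    apply: (@le_trans _ _ (96 * c * enorm a0)); first by rewrite ler_wpM2l // mulr_ge0.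
    by rewrite (le_trans rho1) // lerDl mulr_ge0 ?sqr_ge0 //.
  exists a'; split.
  - exact: le_trans a'a aa.
  - move=> u u1; rewrite process_rcons.
    have bSP : convex_body (S H (process S Hs (msum K (eball r)))).
      by case: fS => sS _ _ _; case: (sS H pH _ bP).
    apply: le_trans (supp_sub u (body_fiber H bP) bSP (fiber_sub_familyF fS pH bP)).
    apply: le_trans (step u u1); rewrite lerD2r.
    have sq : 0 <= enorm a ^+ 2 - enorm a' ^+ 2.
      by rewrite subr_ge0 ler_pXn2r ?nnegrE ?enorm_ge0.
    have : 72 * c ^+ 2 / (rho + k * enorm a ^+ 2) * (enorm a ^+ 2 - enorm a' ^+ 2) <=
        k * (enorm a ^+ 2 - enorm a' ^+ 2).
      rewrite ler_wpM2r // /k ler_wpM2l ?mulr_ge0 ?sqr_ge0 // lef_pV2 ?posrE //.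
      by rewrite lerDl mulr_ge0 ?sqr_ge0 //.
    lra.
  - move=> u u1; rewrite a'E supp_process_minkowski_rcons //.
    have := appM u u1; have := appM (reflection H u); rewrite enorm_reflection => /(_ u1).
    by rewrite !ler_norml; lra.
move=> u u1; have := lowS u u1; have := appM u u1.
have := supp_sub u (body_process fS pHs bKB) (body_process_minkowski Hs bKB)
  (process_sub_minkowski fS pHs bKB).
rewrite supp_process_minkowski_ball // !ler_norml.
have : 0 <= k * enorm a ^+ 2 by rewrite mulr_ge0 ?sqr_ge0 //.
move: ka; rewrite /r; lra.
Qed.

(** Adding a large ball to the initial body turns the given process, up to a
    small error and the constant radius, into the Minkowski process, whose rotated
    bodies are therefore Cauchy as well. *)
Theorem familyF_stable_minkowski S (H_ : nat -> {vspace 'rV[R]_n}) A_ :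
  (forall m, proper_subspace (H_ m)) -> familyF S ->
  shape_stable_with S H_ A_ -> shape_stable_with M H_ A_.
Proof.
move=> pH fS /(shape_stable_withP A_ pH fS)[rA sS].
apply/(shape_stable_withP A_ pH (familyF_minkowski R n)); split=> // k K bK e e0.
have e3 : 0 < e / 3 by rewrite divr_gt0.
have [r r0 hr] := process_large_ball bK e3.
have bKB := body_msum bK (body_eball n r0).
have [N hN] := sS k _ bKB _ e3; exists N => m p u Nm Np u1.
have := hN m p u Nm Np u1.
have AA q : A_ q *m (A_ q)^T = 1%:M by case: (rA q).
have pHs q : all_proper [seq H_ i | i <- index_iota k q.+1] by exact: all_proper_map.
have bS q := body_process fS (pHs q) bKB.
have bM q := body_process_minkowski [seq H_ i | i <- index_iota k q.+1] bK.
have u1' q : enorm (u *m (A_ q)^T) = 1 by rewrite orthogonal_enorm // orthogonal_trmx.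
have hq q := hr S _ fS (pHs q) _ (u1' q).
have := hq m; have := hq p.
rewrite !successiveE !supp_rotate // !ler_norml; lra.
Qed.

Theorem familyF_stable_transfer S T (H_ : nat -> {vspace 'rV[R]_n}) A_ :
  (forall m, proper_subspace (H_ m)) -> familyF S -> familyF T ->
  shape_stable_with S H_ A_ -> shape_stable_with T H_ A_.
Proof.
move=> pH fS fT /(familyF_stable_minkowski pH fS).
exact: minkowski_stable_familyF.
Qed.

End Comparison.

(** * The theorem *)

Theorem theorem3p4 (R : realType) (n : nat)
    (H_ : nat -> {vspace 'rV[R]_n}) (subspaceH : forall m, proper_subspace (H_ m)) :
  (forall S : set_operation R n, familyF S ->
     forall A_ : nat -> 'M[R]_n, shape_stable_with S H_ A_ ->
     forall T : set_operation R n, familyF T -> shape_stable_with T H_ A_) /\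
  (forall S : set_operation R n, familyF S ->
     [/\ forall A_ : nat -> 'M[R]_n,
           shape_stable_with S H_ A_ <-> shape_stable_with (@fiber_symm R n) H_ A_,
         forall A_ : nat -> 'M[R]_n,
           shape_stable_with S H_ A_ <-> shape_stable_with (@minkowski_symm R n) H_ A_,
         shape_stable S H_ <-> shape_stable (@fiber_symm R n) H_ &
         shape_stable S H_ <-> shape_stable (@minkowski_symm R n) H_]) /\
  ((forall m, hyperplane (H_ m)) ->
   forall S : set_operation R n, familyF S ->
     (forall A_ : nat -> 'M[R]_n,
        shape_stable_with S H_ A_ <-> shape_stable_with (@steiner_symm R n) H_ A_) /\
     (shape_stable S H_ <-> shape_stable (@steiner_symm R n) H_)).
Proof.
have fF := familyF_fiber R n; have fM := familyF_minkowski R n.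
have tr := familyF_stable_transfer subspaceH.
have ex S T : (forall A_, shape_stable_with S H_ A_ <-> shape_stable_with T H_ A_) ->
    shape_stable S H_ <-> shape_stable T H_.
  by move=> h; split=> -[A_ /h hA]; exists A_.
split; first by move=> S fS A_ sS T fT; exact: tr sS.
have iffT S T : familyF S -> familyF T ->
    forall A_, shape_stable_with S H_ A_ <-> shape_stable_with T H_ A_.
  by move=> fS fT A_; split; exact: tr.
split=> [S fS|hH S fS]; first by split; do ?[apply: ex]; exact: iffT.
have iffS A_ : shape_stable_with S H_ A_ <-> shape_stable_with (@steiner_symm R n) H_ A_.
  apply: iff_trans (iffT S _ fS fF A_) _.
  have E k m K : convex_body K ->
      successive (@steiner_symm R n) H_ k m K = successive (@fiber_symm R n) H_ k m K.
    move=> bK; rewrite !successiveE process_steiner_fiber // => _ /mapP[i _ ->].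
    exact: hH.
  split=> -[rA h]; split=> // k K bK; have := h k K bK;
    by congr hausdorff_cvg; apply/funext => m; rewrite E.
by split=> //; exact: ex.
Qed.
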